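(* Let $\xi=(\xi_t)_{0\le t\le T}$ be the observed process $$\xi_t=\sum_{i=0}^n\theta_i\varphi_i(t)+\sigma(t)B^H_t,\qquad 0\le t\le T,$$ where $B^H$ is a standard fractional Brownian motion with Hurst index $H\in(0,1)$, let $\mathcal{F}^\xi_t=\sigma(\{\xi_s,\,0\le s\le t\})$, and let $\boldsymbol\theta=(\theta_0,\ldots,\theta_n)^\top$ be a multivariate normal random variable with mean $\mathbf{m}$ and (invertible) covariance matrix $\mathbf{\Sigma}$, independent of $B^H$. Then the optimal Bayesian estimate $\widehat{\boldsymbol\theta}_{\rm BAYES}$ for the value of $\boldsymbol\theta$ (the optimal least squares estimate given $\mathcal{F}^\xi_t$) is the posterior mean $$\widehat{\boldsymbol\theta}_{\rm BAYES}=\mathbf{E}[\boldsymbol\theta\,|\,\mathcal{F}^\xi_t]=\big(R_H(t)+\mathbf{\Sigma}^{-1}\big)^{-1}\big(\boldsymbol\psi^H_t+\mathbf{\Sigma}^{-1}\mathbf{m}\big).$$ The estimation error $\mathbf{E}\big(\|\boldsymbol\theta-\widehat{\boldsymbol\theta}_{\rm BAYES}\|^2\,|\,\mathcal{F}^\xi_t\big)$ is the trace of the posterior covariance matrix $$\mathrm{cov}[\boldsymbol\theta\,|\,\mathcal{F}^\xi_t]=\big(R_H(t)+\mathbf{\Sigma}^{-1}\big)^{-1}.$$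
   Context: A standard fractional Brownian motion $B^H=(B^H_t)_{0\le t\le T}$ with Hurst index $H\in(0,1)$ is a Gaussian process with continuous paths, $B^H_0=0$, $\mathbf{E}\,B^H_t=0$ and $\mathbf{E}\,B^H_sB^H_t=\frac12\left(s^{2H}+t^{2H}-|t-s|^{2H}\right)$. Notation, for $0\le s<t\le T$: $\kappa_H=2H\,\Gamma(\tfrac32-H)\,\Gamma(\tfrac12+H)$, $k_H(t,s)=\kappa_H^{-1}s^{1/2-H}(t-s)^{1/2-H}$, $\lambda_H=\dfrac{2H\,\Gamma(3-2H)\,\Gamma(\frac12+H)}{\Gamma(\frac32-H)}$, $w_H(t)=\lambda_H^{-1}t^{2-2H}$, $dw^H_t=\lambda_H^{-1}(2-2H)t^{1-2H}\,dt$, and $\dfrac{df(t)}{dw^H_t}=\dfrac{\lambda_H}{2-2H}\,t^{2H-1}\,\dfrac{df(t)}{dt}$. The functions $\varphi_i$ are known with $\int_0^T|\varphi_i(t)|\,dt<\infty$; $\sigma$ is known with $\int_0^T|\sigma(t)|^2\,dt<\infty$. The stochastic differential of $\xi$ is written as $d\xi_t=\sum_{i=0}^n\theta_i\varphi_i'(t)\,dt+\sigma(t)\,dB^H_t$. Define, for $i,j=0,\ldots,n$, $$\psi_i(t)=\frac{d}{dw^H_t}\int_0^tk_H(t,s)\,\sigma^{-1}(s)\,\varphi_i'(s)\,ds,\qquad M^H_t=\int_0^tk_H(t,s)\,d\xi_s,$$ $$(\boldsymbol\psi^H_t)_i=\int_0^t\psi_i(s)\,dM^H_s,\qquad(R_H(t))_{ij}=\int_0^t\psi_i(s)\psi_j(s)\,dw^H_s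 ,$$ all derivatives, inverses and integrals written being assumed well defined and $\psi_i\in L^2([0,T],dw^H_t)$. The likelihood process is $\Lambda^H_t(\mathbf{x})=\exp\{\mathbf{x}^\top\boldsymbol\psi^H_t-\frac12\mathbf{x}^\top R_H(t)\mathbf{x}\}$, $\mathbf{x}\in\mathbb{R}^{n+1}$, and the conditional density of $\boldsymbol\theta$ given $\mathcal{F}^\xi_t$ is represented, according to the generalized Bayes rule, by $$p^{\boldsymbol\theta}(\mathbf{x}\,|\,\mathcal{F}^\xi_t)=\frac{p^{\boldsymbol\theta}(\mathbf{x})\,\Lambda^H_t(\mathbf{x})}{\int_{\mathbb{R}^{n+1}}p^{\boldsymbol\theta}(\mathbf{z})\,\Lambda^H_t(\mathbf{z})\,d\mathbf{z}},$$ where $p^{\boldsymbol\theta}$ is the prior density of $\boldsymbol\theta$. *)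

(* Defs.v *)
From HB Require Import structures.
From mathcomp Require Import all_boot all_order all_algebra.
From mathcomp Require Import all_classical all_reals all_analysis.

Set Implicit Arguments.
Unset Strict Implicit.
Unset Printing Implicit Defensive.

Import Order.TTheory GRing.Theory Num.Theory.
Import numFieldNormedType.Exports.

Local Open Scope classical_set_scope.
Local Open Scope ring_scope.

(** * Lebesgue measure on R^k

    As a measurable space, R^k is the type of k-tuples with the product
    sigma-algebra.  [lebesgue_tuple k] is the k-fold product of
    [lebesgue_measure], transported along (x, v) |-> x :: v. *)

Notation Rtuple k R := (k.-tuple (measurableTypeR R)).

Section lebesgue_cons.
Context {R : realType} (k : nat).
Variable nu : {sigma_finite_measure set (Rtuple k R) -> \bar R}.

Definition tuple_consp (p : measurableTypeR R * Rtuple k R) : Rtuple k.+1 R :=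
  [the k.+1.-tuple _ of p.1 :: p.2].

Lemma measurable_tuple_consp : measurable_fun setT tuple_consp.
Proof. exact: (@measurable_cons _ _ _ _ fst k snd). Qed.

Definition lebesgue_cons : set (Rtuple k.+1 R) -> \bar R :=
  pushforward (@lebesgue_measure R \x nu)%E tuple_consp.

Let lebesgue_cons0 : lebesgue_cons set0 = 0%E.
Proof. by rewrite /lebesgue_cons /pushforward preimage_set0 measure0. Qed.

Let lebesgue_cons_ge0 A : (0 <= lebesgue_cons A)%E.
Proof. by rewrite /lebesgue_cons /pushforward measure_ge0. Qed.

Let lebesgue_cons_sigma_additive : semi_sigma_additive lebesgue_cons.
Proof.
move=> F mF tF mUF; rewrite /lebesgue_cons /pushforward preimage_bigcup.
have mpre A : measurable A -> measurable (tuple_consp @^-1` A).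
  by move=> mA; rewrite -[X in measurable X]setTI; exact: measurable_tuple_consp.
apply: measure_semi_sigma_additive.
- by move=> n; exact: mpre.
- apply/trivIsetP => /= i j _ _ ij; rewrite -preimage_setI.
  by move/trivIsetP : tF => /(_ _ _ _ _ ij) ->//; rewrite preimage_set0.
- by rewrite -preimage_bigcup; exact: mpre.
Qed.

HB.instance Definition _ := isMeasure.Build _ _ _ lebesgue_cons
  lebesgue_cons0 lebesgue_cons_ge0 lebesgue_cons_sigma_additive.

Let lebesgue_cons_sigma_finite : sigma_finite setT lebesgue_cons.
Proof.
have /sigma_finiteP[F [FT ndF Foo]] := sigma_finiteT (@lebesgue_measure R).
have /sigma_finiteP[G [GT ndG Goo]] := sigma_finiteT nu.
pose split (v : Rtuple k.+1 R) : measurableTypeR R * Rtuple k R :=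
  (thead v, [tuple of behead v]).
have msplit : measurable_fun setT split.
  by apply: measurable_fun_pair; [exact: measurable_tnth|exact: measurable_behead].
have splitK A : tuple_consp @^-1` (split @^-1` A) = A.
  rewrite -comp_preimage (_ : split \o tuple_consp = id)// funeqE => -[x v].
  by congr pair; exact/val_inj.
exists (fun n => split @^-1` (F n `*` G n)).
  rewrite -preimage_bigcup -[LHS](preimage_setT split); congr (_ @^-1` _).
  rewrite -setXTT FT GT predeqE => -[x y]; split.
    move=> [/= [n _ Fnx] [m _ Gmy]]; exists (maxn n m) => //; split.
    - by move: x Fnx; exact/subsetPset/ndF/leq_maxl.
    - by move: y Gmy; exact/subsetPset/ndG/leq_maxr.
  by move=> [n _ []/= ? ?]; split; exists n.
move=> n; have [mF Fn] := Foo n; have [mG Gn] := Goo n; split.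
  by rewrite -[X in measurable X]setTI; apply: msplit => //; exact: measurableX.
rewrite /lebesgue_cons /pushforward splitK product_measure1E//.
by rewrite lte_mul_pinfty// ge0_fin_numE.
Qed.

HB.instance Definition _ := @Measure_isSigmaFinite.Build _ _ _
  lebesgue_cons lebesgue_cons_sigma_finite.

End lebesgue_cons.

Fixpoint lebesgue_tuple (R : realType) (k : nat) :
    {sigma_finite_measure set (Rtuple k R) -> \bar R} :=
  match k with
  | 0 => [the sigma_finite_measure _ _ of \d_([tuple] : Rtuple 0 R)]
  | k'.+1 => [the sigma_finite_measure _ _ of
               lebesgue_cons (lebesgue_tuple R k')]
  end.

(** [Rintegral] against [lebesgue_tuple k] integrates functions of a column
    vector through [vec]. *)
Definition vec (R : realType) (k : nat) (x : Rtuple k R) : 'cV[R]_k :=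
  \col_(i < k) tnth x i.

Definition unvec (R : realType) (k : nat) (v : 'cV[R]_k) : Rtuple k R :=
  [tuple v i ord0 | i < k].

(** * Vectors and matrices *)

Definition dot (R : realType) (k : nat) (x y : 'cV[R]_k) : R :=
  (x^T *m y) ord0 ord0.

(* The library norm on matrices is the sup norm. *)
Definition sqnorm (R : realType) (k : nat) (x : 'cV[R]_k) : R := dot x x.

Definition covariance_matrix (R : realType) (k : nat) (S : 'M[R]_k) : Prop :=
  S^T = S /\ forall x : 'cV[R]_k, 0 <= dot x (S *m x).

(** * Gaussian laws *)

Definition gaussian_rv d (Omega : measurableType d) (R : realType)
    (P : probability Omega R) (X : Omega -> R) : Prop :=
  exists m s : R, forall A : set R, measurable A ->
    P (X @^-1` A) = if s == 0 then \d_m A else normal_prob m s A.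

(* Density of the normal law on R^k with mean [m] and invertible covariance
   matrix [S]. *)
Definition mvnormal_pdf (R : realType) (k : nat) (m : 'cV[R]_k) (S : 'M[R]_k)
    (x : 'cV[R]_k) : R :=
  (Num.sqrt ((pi *+ 2) ^+ k * \det S))^-1 *
  expR (- (2^-1 * dot (x - m) (invmx S *m (x - m)))).

Definition has_density d (Omega : measurableType d) (R : realType)
    (P : probability Omega R) (k : nat) (X : Omega -> 'cV[R]_k)
    (p : 'cV[R]_k -> R) : Prop :=
  forall A : set (Rtuple k R), measurable A ->
    P ((@unvec R k \o X) @^-1` A) =
    (\int[lebesgue_tuple R k]_(x in A) (p (vec x))%:E)%E.

(** * Sigma-algebras, independence, conditioning *)

Definition sigma_gen d (Omega : measurableType d) (R : realType) (I : Type)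
    (D : set I) (X : I -> Omega -> R) : set (set Omega) :=
  <<s \bigcup_(i in D) preimage_set_system setT (X i) measurable >>.

Definition independent_sigma d (Omega : measurableType d) (R : realType)
    (P : probability Omega R) (F G : set (set Omega)) : Prop :=
  forall A B, F A -> G B -> P (A `&` B) = (P A * P B)%E.

Definition measurable_wrt d (Omega : measurableType d) (R : realType)
    (G : set (set Omega)) (Y : Omega -> R) : Prop :=
  forall A : set R, measurable A -> G (Y @^-1` A).

(* [Y] is a version of E[X | G]. *)
Definition is_cond_exp d (Omega : measurableType d) (R : realType)
    (P : probability Omega R) (G : set (set Omega)) (X Y : Omega -> R) : Prop :=
  [/\ P.-integrable setT (EFin \o X), P.-integrable setT (EFin \o Y),
      measurable_wrt G Y &
      forall A, G A ->
        (\int[P]_(w in A) (Y w)%:E = \int[P]_(w in A) (X w)%:E)%E].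

(* E[X | G] = Z almost surely.  [Z] itself need not be G-measurable: G is not
   assumed to contain the P-null sets. *)
Definition cond_exp_eq d (Omega : measurableType d) (R : realType)
    (P : probability Omega R) (G : set (set Omega)) (X Z : Omega -> R) : Prop :=
  exists2 Y, is_cond_exp P G X Y & {ae P, forall w, Y w = Z w}.

Definition is_cond_mean d (Omega : measurableType d) (R : realType)
    (P : probability Omega R) (G : set (set Omega)) (k : nat)
    (X Y : Omega -> 'cV[R]_k) : Prop :=
  forall i, is_cond_exp P G (fun w => X w i ord0) (fun w => Y w i ord0).

(* [K] is a version of cov[X | G]. *)
Definition is_cond_cov d (Omega : measurableType d) (R : realType)
    (P : probability Omega R) (G : set (set Omega)) (k : nat)
    (X : Omega -> 'cV[R]_k) (K : Omega -> 'M[R]_k) : Prop :=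
  exists2 Y, is_cond_mean P G X Y &
    forall i j, is_cond_exp P G
      (fun w => (X w i ord0 - Y w i ord0) * (X w j ord0 - Y w j ord0))
      (fun w => K w i j).

(* [p x w] is the conditional density at x of X given G, at the outcome w. *)
Definition is_cond_density d (Omega : measurableType d) (R : realType)
    (P : probability Omega R) (G : set (set Omega)) (k : nat)
    (X : Omega -> 'cV[R]_k) (p : 'cV[R]_k -> Omega -> R) : Prop :=
  forall A : set (Rtuple k R), measurable A ->
    cond_exp_eq P G (fun w => \1_A (unvec (X w)))
      (fun w => \int[lebesgue_tuple R k]_(x in A) p (vec x) w).

(* Optimal least squares estimate of X among the G-measurable vectors; the
   mean square errors are compared in [0, +oo]. *)
Definition is_ls_estimate d (Omega : measurableType d) (R : realType)
    (P : probability Omega R) (G : set (set Omega)) (k : nat)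
    (X est : Omega -> 'cV[R]_k) : Prop :=
  let measurable_est (Y : Omega -> 'cV[R]_k) :=
    forall i, measurable_wrt G (fun w => Y w i ord0) in
  measurable_est est /\
  forall Y, measurable_est Y ->
    ('E_P[(fun w => sqnorm (X w - est w))%R] <=
     'E_P[(fun w => sqnorm (X w - Y w))%R])%E.

(** * Fractional Brownian motion and the associated kernels *)

Definition is_fBm d (Omega : measurableType d) (R : realType)
    (P : probability Omega R) (T H : R) (B : R -> {RV P >-> R}) : Prop :=
  [/\ forall a : seq (R * R), (forall p, p \in a -> 0 <= p.1 <= T) ->
        gaussian_rv P (fun w => \sum_(p <- a) p.2 * B p.1 w),
      forall w, {within `[0, T], continuous (fun s => B s w)},
      forall w, B 0 w = 0,
      forall s, 0 <= s <= T -> ('E_P[B s] = 0)%E &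
      forall s t, 0 <= s <= T -> 0 <= t <= T ->
        ('E_P[(fun w => B s w * B t w)%R])%E =
        (2^-1 * (s `^ (2 * H) + t `^ (2 * H) - `|t - s| `^ (2 * H)))%:E].

(* Euler's Gamma function, used below at positive arguments only. *)
Definition Gamma (R : realType) (x : R) : R :=
  \int[@lebesgue_measure R]_(t in `]0, +oo[) (t `^ (x - 1) * expR (- t)).

Definition kappaH (R : realType) (H : R) : R :=
  2 * H * Gamma (3 / 2 - H) * Gamma (1 / 2 + H).

Definition kH (R : realType) (H t s : R) : R :=
  (kappaH H)^-1 * s `^ (1 / 2 - H) * (t - s) `^ (1 / 2 - H).

Definition lambdaH (R : realType) (H : R) : R :=
  2 * H * Gamma (3 - 2 * H) * Gamma (1 / 2 + H) / Gamma (3 / 2 - H).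

(* Density of dw^H with respect to Lebesgue measure. *)
Definition dwH (R : realType) (H t : R) : R :=
  (lambdaH H)^-1 * (2 - 2 * H) * t `^ (1 - 2 * H).

Definition derive_wH (R : realType) (H : R) (f : R -> R) (t : R) : R :=
  lambdaH H / (2 - 2 * H) * t `^ (2 * H - 1) * derive1 f t.

(** * Integrals of deterministic functions

    A step function on [0, t] is a list of triples ((a, b), c) standing for
    the sum of the functions c 1_]a, b]; its integral against a process X is
    the sum of the c (X_b - X_a).  An integral of f against X over [0, t] is a
    mean square limit of integrals of step functions which converge to f for
    a prescribed size functional N.

    For X = B^H we take for N the norm of L^1([0, t]).  This determines the
    integral almost surely for every H in ]0, 1[: the mean square norm of a
    step integral is a multiple of the L^2 norm of |x|^(1/2-H) times the
    Fourier transform of the step function, and that transform tends to 0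
    uniformly when the step functions tend to 0 in L^1.  For X = M^H we take
    the square of the norm of L^2([0, t], dw^H). *)

Definition step_fun (R : realType) (g : seq (R * R * R)) (s : R) : R :=
  \sum_(j <- g) j.2 * \1_`]j.1.1, j.1.2] s.

Definition step_integral (R : realType) (Omega : Type) (X : R -> Omega -> R)
    (g : seq (R * R * R)) (w : Omega) : R :=
  \sum_(j <- g) j.2 * (X j.1.2 w - X j.1.1 w).

Definition is_integral d (Omega : measurableType d) (R : realType)
    (P : probability Omega R) (N : (R -> R) -> \bar R)
    (X : R -> {RV P >-> R}) (t : R) (f : R -> R) (I : {RV P >-> R}) : Prop :=
  exists g : nat -> seq (R * R * R),
    [/\ forall k j, j \in g k -> 0 <= j.1.1 <= j.1.2 /\ j.1.2 <= t,
        N (fun s => step_fun (g k) s - f s) @[k --> \oo] --> 0%E &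
        ('E_P[(fun w => (step_integral X (g k) w - I w) ^+ 2)%R])%E
          @[k --> \oo] --> 0%E].

Definition L1_size (R : realType) (t : R) (h : R -> R) : \bar R :=
  (\int[@lebesgue_measure R]_(s in `[0%R, t]) `|h s|%:E)%E.

Definition L2w_size (R : realType) (H t : R) (h : R -> R) : \bar R :=
  (\int[@lebesgue_measure R]_(s in `[0%R, t]) (h s ^+ 2 * dwH H s)%:E)%E.

(** * The observation model *)

Definition observed d (Omega : measurableType d) (R : realType)
    (P : probability Omega R) (n : nat) (phi : 'I_n.+1 -> R -> R)
    (sigma : R -> R) (theta : 'I_n.+1 -> {RV P >-> R})
    (B : R -> {RV P >-> R}) (t : R) (w : Omega) : R :=
  \sum_(i < n.+1) theta i w * phi i t + sigma t * B t w.

(* [I] is a version of the integral of f over [0, t] against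
   dxi = sum_i theta_i phi_i'(s) ds + sigma(s) dB_s. *)
Definition is_dxi_integral d (Omega : measurableType d) (R : realType)
    (P : probability Omega R) (n : nat) (phi : 'I_n.+1 -> R -> R)
    (sigma : R -> R) (theta : 'I_n.+1 -> {RV P >-> R})
    (B : R -> {RV P >-> R}) (t : R) (f : R -> R) (I : {RV P >-> R}) : Prop :=
  exists2 J : {RV P >-> R},
    is_integral (L1_size t) B t (fun s => f s * sigma s) J &
    {ae P, forall w, I w =
      \sum_(i < n.+1) theta i w *
        (\int[@lebesgue_measure R]_(s in `[0, t]) (f s * derive1 (phi i) s)) + J w}.

(* The function which is differentiated in the definition of psi_i. *)
Definition kernel_transform (R : realType) (H : R) (sigma phi : R -> R)
    (t : R) : R :=
  \int[@lebesgue_measure R]_(s in `[0, t])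
    (kH H t s * (sigma s)^-1 * derive1 phi s).

Definition psi (R : realType) (n : nat) (H : R) (phi : 'I_n.+1 -> R -> R)
    (sigma : R -> R) (i : 'I_n.+1) (t : R) : R :=
  derive_wH H (kernel_transform H sigma (phi i)) t.

Definition RH (R : realType) (n : nat) (H : R) (phi : 'I_n.+1 -> R -> R)
    (sigma : R -> R) (t : R) : 'M[R]_n.+1 :=
  \matrix_(i, j) \int[@lebesgue_measure R]_(s in `[0, t])
    (psi H phi sigma i s * psi H phi sigma j s * dwH H s).

(** * Likelihood and generalized Bayes rule *)

Definition likelihood (R : realType) (k : nat) (v : 'cV[R]_k) (S : 'M[R]_k)
    (x : 'cV[R]_k) : R :=
  expR (dot x v - 2^-1 * dot x (S *m x)).

Definition bayes_density (R : realType) (k : nat) (prior L : 'cV[R]_k -> R)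
    (x : 'cV[R]_k) : R :=
  prior x * L x / \int[lebesgue_tuple R k]_z (prior (vec z) * L (vec z)).

(* Main.v *)
Require Import Defs.
From HB Require Import structures.
From mathcomp Require Import all_boot all_order all_algebra.
From mathcomp Require Import all_classical all_reals all_analysis.
From mathcomp Require Import measurable_realfun ring lra.

Set Implicit Arguments.
Unset Strict Implicit.
Unset Printing Implicit Defensive.

Import Order.TTheory GRing.Theory Num.Theory.
Import numFieldNormedType.Exports.

Local Open Scope classical_set_scope.
Local Open Scope ring_scope.

(** By the generalized Bayes rule, the conditional density of Theta given the
    observed sigma-algebra F is the product of the normal prior, with mean m
    and covariance matrix S, and the likelihood
    exp (x.Psi - x.R x / 2), up to normalisation. Both factors are exponentials
    of quadratic functions of x. Completing the square shows that the quotient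
    is g (x - mu), where g is the centred normal density with precision matrix
    A = R + S^-1, which is deterministic, and mu = A^-1 (Psi + S^-1 m)
    ([bayes_density_gpdf]). So, given F, Theta is mu plus a vector whose law
    does not depend on the outcome. The matrix A is positive definite because R
    is a Gram matrix ([gram_ge0]).

    The moments of g need no explicit Gaussian integral. The mass of
    exp (- x.A x / 2) is finite and positive by comparison with the prior,
    whose mass is one ([gmass_le]). Translation invariance of Lebesgue measure
    then gives the moment generating function exp (b.A^-1 b / 2)
    ([gpdf_mgf]), and expanding it to second order in b gives mean 0 and
    covariance matrix A^-1 ([gaussian_moments]).

    The vector mu need be F-measurable only up to a null set: each coordinate
    is recovered from the conditional probability of a half space, of which it is
    a measurable function ([cond_location_version]). Call Y the resulting
    F-measurable version. The joint law of F and Theta agrees on rectangles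
    with the product of P restricted to F and g, sheared by Y; hence the
    residual Theta - Y is independent of F and has density g
    ([ge0_integral_residual]).

    Independence and Tonelli give
    E |Theta - W|^2 = tr A^-1 + E |Y - W|^2
    for every F-measurable W ([mse_location]), so that Y is optimal and every
    optimal estimate equals Y almost surely. The conditional mean and the
    conditional covariance matrix follow from the moments of the residual and
    the uniqueness of conditional expectations ([ls_location]). *)

(** * Quadratic forms *)

Section dot.
Context {R : realType} {k : nat}.
Implicit Types (x y z : 'cV[R]_k) (S : 'M[R]_k).

Lemma dotE x y : dot x y = \sum_i x i 0 * y i 0.
Proof. by rewrite /dot mxE; apply: eq_bigr => i _; rewrite mxE. Qed.

Lemma dotC x y : dot x y = dot y x.
Proof. by rewrite !dotE; apply: eq_bigr => i _; rewrite mulrC. Qed.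

Lemma dotDl x y z : dot (x + y) z = dot x z + dot y z.
Proof. by rewrite /dot linearD mulmxDl mxE. Qed.

Lemma dotDr x y z : dot x (y + z) = dot x y + dot x z.
Proof. by rewrite /dot mulmxDr mxE. Qed.

Lemma dotZl a x y : dot (a *: x) y = a * dot x y.
Proof. by rewrite /dot linearZ -scalemxAl mxE. Qed.

Lemma dotZr a x y : dot x (a *: y) = a * dot x y.
Proof. by rewrite dotC dotZl dotC. Qed.

Lemma dotNl x y : dot (- x) y = - dot x y.
Proof. by rewrite -scaleN1r dotZl mulN1r. Qed.

Lemma dotNr x y : dot x (- y) = - dot x y.
Proof. by rewrite dotC dotNl dotC. Qed.

Lemma dot_mulmx S x y : dot x (S *m y) = dot (S^T *m x) y.
Proof. by rewrite /dot trmx_mul trmxK mulmxA. Qed.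

Lemma dot_sym S x y : S^T = S -> dot x (S *m y) = dot y (S *m x).
Proof. by move=> sS; rewrite dot_mulmx sS dotC. Qed.

Lemma dot_delta (i : 'I_k) x : dot (delta_mx i 0) x = x i 0.
Proof.
rewrite dotE (bigD1 i)//= mxE !eqxx mul1r big1 ?addr0// => j ji.
by rewrite mxE (negbTE ji) mul0r.
Qed.

Lemma sqnormE x : sqnorm x = \sum_i x i 0 ^+ 2.
Proof. by rewrite /sqnorm dotE; apply: eq_bigr => i _; rewrite expr2. Qed.

Lemma sqnorm_ge0 x : 0 <= sqnorm x.
Proof. by rewrite sqnormE; apply: sumr_ge0 => i _; exact: sqr_ge0. Qed.

Lemma sqnorm_eq0 x : sqnorm x = 0 -> x = 0.
Proof.
rewrite sqnormE => /eqP; rewrite psumr_eq0; last by move=> i _; exact: sqr_ge0.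
by move/allP => x0; apply/matrixP => i j; rewrite ord1 mxE; apply/eqP;
  rewrite -sqrf_eq0; apply: x0; rewrite mem_index_enum.
Qed.

Lemma sqnorm0 : sqnorm (0 : 'cV[R]_k) = 0.
Proof. by rewrite sqnormE big1// => i _; rewrite mxE expr0n. Qed.

Definition posdef S : Prop :=
  S^T = S /\ forall x, x != 0 -> 0 < dot x (S *m x).

Lemma posdef_unit S : posdef S -> S \in unitmx.
Proof.
move=> [sS pS]; rewrite unitmxE -det_tr -unitmxE -row_free_unit -kermx_eq0.
apply/rowV0P => v /sub_kermxP vS; apply/eqP; apply: contraT => v0.
have := pS v^T; rewrite -{1}trmx0 (inj_eq trmx_inj) => /(_ v0).
by rewrite -[S]trmxK -trmx_mul vS trmx0 /dot mulmx0 mxE ltxx.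
Qed.

Lemma invmx_sym S : S^T = S -> (invmx S)^T = invmx S.
Proof. by move=> sS; rewrite trmx_inv sS. Qed.

Lemma covariance_posdef S : covariance_matrix S -> S \in unitmx -> posdef S.
Proof.
move=> [sS pS] uS; split=> // x x0; rewrite lt_neqAle pS andbT eq_sym.
apply: contra_neq x0 => Sx0; suff : S *m x = 0.
  by move/(congr1 (mulmx (invmx S))); rewrite mulKmx// mulmx0.
apply: sqnorm_eq0; apply/eqP; rewrite eq_le sqnorm_ge0 andbT leNgt; apply/negP.
set y := S *m x => y0.
(* The form equals - 2 e |y|^2 + e^2 c at x - e y, which is negative for this
   small e. *)
pose c := dot y (S *m y); have c0 : 0 <= c by exact: pS.
pose e := sqnorm y / (c + 1).
have xSy : dot x (S *m y) = sqnorm y by rewrite dot_sym.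
have e0 : 0 < e by rewrite divr_gt0// ltr_wpDl.
have ec : e * (c + 1) = sqnorm y by rewrite /e divfK// gt_eqF// ltr_wpDl.
have := pS (x - e *: y).
rewrite mulmxBr -scalemxAr -/y !(dotDl, dotDr, dotNl, dotNr, dotZl, dotZr).
rewrite Sx0 xSy -/(sqnorm y) -/c => h.
have : 0 < e * sqnorm y by rewrite mulr_gt0.
have : 0 <= e * e by rewrite mulr_ge0// ltW.
have : e * (e * (c + 1)) = e * sqnorm y by rewrite ec.
move: h; lra.
Qed.

Lemma posdef_inv S : posdef S -> posdef (invmx S).
Proof.
move=> pS; have uS := posdef_unit pS; have [sS gt0S] := pS.
split=> [|x x0]; first exact: invmx_sym.
have -> : dot x (invmx S *m x) = dot (invmx S *m x) (S *m (invmx S *m x)).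
  by rewrite mulKVmx// dotC.
by apply: gt0S; apply: contra_neq x0 => /(congr1 (mulmx S));
  rewrite mulKVmx// mulmx0.
Qed.

Lemma posdefD_psd S S' : S^T = S -> (forall x, 0 <= dot x (S *m x)) ->
  posdef S' -> posdef (S + S').
Proof.
move=> sS pS [sS' pS']; split=> [|x x0]; first by rewrite linearD/= sS sS'.
by rewrite mulmxDl dotDr ltr_wpDl// pS'.
Qed.

(** Completing the square: [c] is where the quadratic function
    x |-> b.x - x.Sx/2 is stationary. *)
Lemma complete_square S b c x : S^T = S -> S *m c = b ->
  dot b x - 2^-1 * dot x (S *m x) =
  - (2^-1 * dot (x - c) (S *m (x - c))) + 2^-1 * dot b c.
Proof.
move=> sS Scb; rewrite mulmxBr !(dotDl, dotDr, dotNl, dotNr) Scb.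
by rewrite (dot_sym c x sS) Scb (dotC x b) (dotC c b); field.
Qed.

End dot.
(** * Translation invariance of Lebesgue measure *)

Section measurable_vectors.
Context d (T : measurableType d) {R : realType} {k : nat}.
Implicit Types f g : T -> 'cV[R]_k.

(** Measurability of a vector valued map, tested on coordinates. It amounts to
    measurability of [unvec] of the map, by [measurable_unvec] and
    [mcoord_vec]. *)
Definition mcoord f := forall i, measurable_fun setT (fun w => f w i ord0).

Lemma mcoord_cst c : mcoord (cst c).
Proof. by move=> i; exact: measurable_cst. Qed.

Lemma mcoordD f g : mcoord f -> mcoord g -> mcoord (fun w => f w + g w).
Proof.
move=> mf mg i; rewrite (_ : (fun _ => _) = (fun w => f w i ord0 + g w i ord0)).
  exact: measurable_funD.
by apply/funext => w; rewrite mxE.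
Qed.

Lemma mcoordN f : mcoord f -> mcoord (fun w => - f w).
Proof.
move=> mf i; rewrite (_ : (fun _ => _) = (fun w => - f w i ord0)).
  exact: measurableT_comp.
by apply/funext => w; rewrite mxE.
Qed.

Lemma mcoordB f g : mcoord f -> mcoord g -> mcoord (fun w => f w - g w).
Proof. by move=> mf mg; apply: mcoordD => //; exact: mcoordN. Qed.

Lemma mcoord_mulmx (S : 'M[R]_k) f : mcoord f -> mcoord (fun w => S *m f w).
Proof.
move=> mf i.
rewrite (_ : (fun _ => _) = (fun w => \sum_j (S i j * f w j ord0))).
  by apply: measurable_sum => j; apply: measurable_funM.
by apply/funext => w; rewrite mxE.
Qed.

Lemma measurable_dot f g : mcoord f -> mcoord g ->
  measurable_fun setT (fun w => dot (f w) (g w)).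
Proof.
move=> mf mg.
rewrite (_ : (fun _ => _) = (fun w => \sum_i (f w i ord0 * g w i ord0))).
  by apply: measurable_sum => j; apply: measurable_funM.
by apply/funext => w; rewrite dotE.
Qed.

Lemma measurable_unvec f : mcoord f ->
  measurable_fun setT (fun w => unvec (f w) : Rtuple k R).
Proof.
move=> mf; apply/measurable_fun_tnthP => i.
rewrite (_ : _ \o _ = (fun w => f w i ord0)); first exact: mf.
by apply/funext => w /=; rewrite tnth_mktuple.
Qed.

Lemma mcoord_vec (X : T -> Rtuple k R) : measurable_fun setT X ->
  mcoord (fun w => vec (X w)).
Proof.
move=> mX i; rewrite (_ : (fun _ => _) = (tnth (T:=_))^~ i \o X).
  by apply: measurableT_comp => //; exact: measurable_tnth.
by apply/funext => w; rewrite mxE.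
Qed.

End measurable_vectors.

Lemma vecK (R : realType) k : cancel (@vec R k) (@unvec R k).
Proof. by move=> x; apply: eq_from_tnth => i; rewrite tnth_mktuple mxE. Qed.

Lemma unvecK (R : realType) k : cancel (@unvec R k) (@vec R k).
Proof. by move=> x; apply/colP => i; rewrite mxE tnth_mktuple. Qed.

Definition tshift (R : realType) k (c : 'cV[R]_k) (x : Rtuple k R) :
  Rtuple k R := unvec (vec x + c).

Lemma measurable_tshift (R : realType) k (c : 'cV[R]_k) :
  measurable_fun setT (tshift c).
Proof.
apply: measurable_unvec; apply: mcoordD; last exact: mcoord_cst.
exact: mcoord_vec.
Qed.

Section translation.
Context {R : realType}.

Lemma lebesgue_measureD (c : R) (A : set (measurableTypeR R)) :
  measurable A -> lebesgue_measure ((fun x => x + c) @^-1` A) =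
                  lebesgue_measure A.
Proof.
move=> mA.
have mc : measurable_fun setT
    (fun x : measurableTypeR R => x + c : measurableTypeR R).
  exact: measurable_funD.
apply/esym.
apply: (lebesgue_measure_unique
  (mu :=
    measure_function_pushforward__canonical__measure_function_Measure _ mc))
  => //=.
move=> _ [[a b]] _ <-.
rewrite /pushforward.
have -> : (fun x : R => x + c) @^-1` [set` `]a, b]%O] =
    [set` `](a - c), (b - c)]%O].
  by apply/seteqP; split=> x /=; rewrite !in_itv/= ltrBlDr lerBrDr.
by rewrite !lebesgue_measure_itv/= !lte_fin ltrD2r -!EFinD; case: ifP => // _;
  congr EFin; lra.
Qed.

(** Both measures are products, so equality on rectangles is enough, and there
    it is the one-dimensional case times the induction hypothesis. *)
Lemma lebesgue_tuple_tshift k (c : 'cV[R]_k) (A : set (Rtuple k R)) :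
  measurable A -> lebesgue_tuple R k (tshift c @^-1` A) = lebesgue_tuple R k A.
Proof.
elim: k c A => [|k IH] c A mA.
  rewrite (_ : tshift c = id)//.
  by apply/funext => x; rewrite [RHS]tuple0 [LHS]tuple0.
pose c' : 'cV[R]_k := \col_i c (lift ord0 i) ord0.
pose h (p : measurableTypeR R * Rtuple k R) : measurableTypeR R * Rtuple k R :=
  (p.1 + c ord0 ord0, tshift c' p.2).
have mc : measurable_fun setT
    (fun x : measurableTypeR R => x + c ord0 ord0 : measurableTypeR R).
  exact: measurable_funD.
have mh : measurable_fun setT h.
  apply: measurable_fun_pair; first exact: measurableT_comp mc _.
  by apply: measurableT_comp => //; exact: measurable_tshift.
rewrite /= /lebesgue_cons /pushforward.
have hE p : tshift c (tuple_consp p) = tuple_consp (h p).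
  case: p => x v; apply: eq_from_tnth => i; rewrite tnth_mktuple !mxE.
  have [j|] := unliftP ord0 i => ->; last by rewrite !(tnth_nth 0).
  by rewrite !tnthS tnth_mktuple !mxE.
have -> : @tuple_consp R k @^-1` (tshift c @^-1` A) =
    h @^-1` (@tuple_consp R k @^-1` A).
  by apply/seteqP; split=> p /=; rewrite hE.
apply/esym.
apply: (product_measure_unique
  (m' :=
    measure_function_pushforward__canonical__measure_function_Measure _ mh))
  => //=.
  move=> B C mB mC.
  rewrite /pushforward.
  rewrite (_ : h @^-1` _ =
    ((fun x => x + c ord0 ord0) @^-1` B) `*` (tshift c' @^-1` C))//.
  rewrite product_measure1E//.
  - by rewrite (IH c')//; congr (_ * _)%E; exact: lebesgue_measureD.
  - by rewrite -[X in measurable X]setTI; exact: mc.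
  - by rewrite -[X in measurable X]setTI; exact: measurable_tshift.
by rewrite -[X in measurable X]setTI; exact: measurable_tuple_consp.
Qed.

Lemma ge0_integral_tshift k (c : 'cV[R]_k) (f : Rtuple k R -> \bar R) :
  measurable_fun setT f -> (forall x, (0 <= f x)%E) ->
  (\int[lebesgue_tuple R k]_x f (tshift c x) =
   \int[lebesgue_tuple R k]_x f x)%E.
Proof.
move=> mf f0; have mc := measurable_tshift c.
rewrite -[LHS]/(\int[lebesgue_tuple R k]_(x in tshift c @^-1` setT)
  (f \o tshift c) x)%E.
rewrite -ge0_integral_pushforward//.
by apply: eq_measure_integral => A mA _; exact: lebesgue_tuple_tshift.
Qed.

End translation.
(** * Measures with a density *)

Section density.
Context d (T : measurableType d) {R : realType}.
Local Open Scope ereal_scope.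

(** [p] agrees almost everywhere with the Radon-Nikodym derivative of [nu]. *)
Lemma integral_density (mu : {sigma_finite_measure set T -> \bar R})
    (nu : {finite_measure set T -> \bar R}) (p : T -> R) :
  measurable_fun setT p -> (forall x, (0 <= p x)%R) ->
  (forall A, measurable A -> nu A = \int[mu]_(x in A) (p x)%:E) ->
  forall f : T -> \bar R, measurable_fun setT f -> (forall x, 0 <= f x) ->
  \int[nu]_x f x = \int[mu]_x (f x * (p x)%:E).
Proof.
move=> mp p0 nuE f mf f0.
have mpE : measurable_fun setT (EFin \o p) by exact/measurable_EFinP.
have numu : nu `<< mu.
  apply/null_content_dominatesP => A mA muA; rewrite nuE//.
  by apply: null_set_integral => //; exact: measurable_funTS.
rewrite -(Radon_Nikodym_SigmaFinite.change_of_variables numu)//.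
have mq := measurable_int _ (Radon_Nikodym_SigmaFinite.f_integrable numu).
apply: ae_eq_integral => //; [exact: emeasurable_funM..|].
apply: ae_eqe_mul2l; apply: integral_ae_eq => //.
  exact: Radon_Nikodym_SigmaFinite.f_integrable.
by move=> E _ mE; rewrite -nuE// -Radon_Nikodym_SigmaFinite.f_integral.
Qed.

End density.

Section density_measure.
Context d (T : measurableType d) {R : realType}.
Variables (mu : {measure set T -> \bar R}) (p : T -> R).
Hypotheses (mp : measurable_fun setT p) (p0 : forall x, 0 <= p x)
  (p1 : (\int[mu]_x (p x)%:E = 1)%E).

Definition density_measure (A : set T) : \bar R :=
  (\int[mu]_(x in A) (p x)%:E)%E.

Let density0 : density_measure set0 = 0%E.
Proof. by rewrite /density_measure integral_set0. Qed.

Let density_ge0 A : (0 <= density_measure A)%E.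
Proof. by apply: integral_ge0 => x _; rewrite lee_fin. Qed.

Let density_sigma_additive : semi_sigma_additive density_measure.
Proof.
apply: semi_sigma_additive_nng_induced; first exact/measurable_EFinP.
by move=> x; rewrite lee_fin.
Qed.

HB.instance Definition _ := isMeasure.Build _ _ _ density_measure
  density0 density_ge0 density_sigma_additive.

HB.instance Definition _ :=
  @Measure_isProbability.Build _ _ R density_measure p1.

Definition density_prob : probability T R := density_measure.

End density_measure.
(** * Gaussian densities *)

Section gaussian.
Context {R : realType} {k : nat}.
Local Notation lam := (lebesgue_tuple R k).
Implicit Types (A S : 'M[R]_k) (a b x y : 'cV[R]_k).

(** The unnormalised centred normal density with precision matrix [A]. *)
Definition gexp A y : R := expR (- (2^-1 * dot y (A *m y))).

Definition gmass A : \bar R := (\int[lam]_x (gexp A (vec x))%:E)%E.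

Definition gpdf A y : R := gexp A y / fine (gmass A).

Lemma measurable_gexp A a :
  measurable_fun setT (fun x : Rtuple k R => gexp A (vec x - a)).
Proof.
apply: measurableT_comp => //; apply: measurableT_comp => //.
apply: measurable_funM => //.
have mx : mcoord (fun x : Rtuple k R => vec x - a).
  by apply: mcoordB; [exact: mcoord_vec|exact: mcoord_cst].
by apply: measurable_dot => //; exact: mcoord_mulmx.
Qed.

Lemma gexp_gt0 A y : 0 < gexp A y.
Proof. exact: expR_gt0. Qed.

Lemma integral_gexp A a : (\int[lam]_x (gexp A (vec x - a))%:E = gmass A)%E.
Proof.
have mg : measurable_fun setT (fun x : Rtuple k R => (gexp A (vec x))%:E).
  apply/measurable_EFinP; have := @measurable_gexp A 0.
  by under eq_fun do rewrite subr0.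
rewrite /gmass -(ge0_integral_tshift (- a) mg).
  by apply: eq_integral => x _; rewrite /tshift unvecK.
by move=> x; rewrite lee_fin ltW// gexp_gt0.
Qed.

(** Finiteness is by comparison. As for positivity, if the integral of the
    positive function [gexp A] vanished, Lebesgue measure would be zero, and
    so would be the mass of [S]. *)
Lemma gmass_le A S : (forall x, dot x (S *m x) <= dot x (A *m x)) ->
  (0 < gmass S < +oo)%E -> (0 < gmass A < +oo)%E.
Proof.
move=> SA /andP[S0 Soo].
have m0 S' : measurable_fun setT (fun x : Rtuple k R => (gexp S' (vec x))%:E).
  apply/measurable_EFinP; have := @measurable_gexp S' 0.
  by under eq_fun do rewrite subr0.
have ge0 S' (x : Rtuple k R) : (0 <= (gexp S' (vec x))%:E)%E.
  by rewrite lee_fin ltW// gexp_gt0.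
apply/andP; split; last first.
  apply: le_lt_trans Soo; apply: ge0_le_integral => // x _.
  by rewrite lee_fin ler_expR lerN2 ler_pM2l// invr_gt0.
rewrite lt_neqAle integral_ge0// andbT; apply: contraTneq S0 => /esym A0.
suff -> : gmass S = 0%E by rewrite ltxx.
have /ae_eq_integral_abs : (\int[lam]_x `|(gexp A (vec x))%:E| = 0)%E.
  by rewrite -[RHS]A0; apply: eq_integral => x _; rewrite gee0_abs.
move=> /(_ measurableT (m0 A)) [N [mN N0 AN]].
have NT : N = setT.
  apply/seteqP; split=> // x _; apply: AN => /= /(_ Logic.I) [] /eqP.
  by rewrite gt_eqF// gexp_gt0.
have := null_set_integral mN (measurable_funTS (m0 S)) N0; rewrite NT; exact.
Qed.

Section normalized.
Variable A : 'M[R]_k.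
Hypotheses (A_sym : A^T = A) (A_unit : A \in unitmx)
  (A_mass : (0 < gmass A < +oo)%E).

Let mass_fin : gmass A = (fine (gmass A))%:E.
Proof. by case/andP: A_mass => A0 Aoo; rewrite fineK// gt0_fin_numE. Qed.

Let mass_gt0 : 0 < fine (gmass A).
Proof. by rewrite fine_gt0. Qed.

Lemma gpdf_gt0 y : 0 < gpdf A y.
Proof. by rewrite divr_gt0// gexp_gt0. Qed.

Lemma measurable_gpdf a :
  measurable_fun setT (fun x : Rtuple k R => gpdf A (vec x - a)).
Proof. by apply: measurable_funM => //; exact: measurable_gexp. Qed.

Lemma integral_gpdf a : (\int[lam]_x (gpdf A (vec x - a))%:E = 1)%E.
Proof.
under eq_integral do rewrite /gpdf mulrC EFinM.
rewrite ge0_integralZl//.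
- by rewrite integral_gexp mass_fin -EFinM /= mulVf// gt_eqF.
- by apply/measurable_EFinP; exact: measurable_gexp.
- by move=> x _; rewrite lee_fin ltW// gexp_gt0.
- by rewrite lee_fin invr_ge0 ltW.
Qed.

(** Tilting by exp (b.x) moves the centre of the density from 0 to A^-1 b. *)
Lemma gpdf_mgf b :
  (\int[lam]_x (expR (dot b (vec x)) * gpdf A (vec x - 0))%:E =
   (expR (2^-1 * dot b (invmx A *m b)))%:E)%E.
Proof.
pose c := invmx A *m b; have Ac : A *m c = b by rewrite mulKVmx.
transitivity (\int[lam]_x ((expR (2^-1 * dot b c))%:E *
    (gpdf A (vec x - c))%:E))%E.
  apply: eq_integral => x _; rewrite -EFinM /gpdf mulrA [in RHS]mulrA subr0.
  congr (_ / _)%:E; rewrite -!expRD; congr expR.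
  by rewrite (complete_square _ A_sym Ac) addrC.
rewrite ge0_integralZl//.
- by rewrite integral_gpdf mule1.
- by apply/measurable_EFinP; exact: measurable_gpdf.
- by move=> x _; rewrite lee_fin ltW// gpdf_gt0.
Qed.

End normalized.

(** No Gaussian integral is computed: since the prior density has total mass
    one, its normalising constant must be the inverse of the mass. *)
Lemma mvnormal_gpdf a S : (\int[lam]_x (mvnormal_pdf a S (vec x))%:E = 1)%E ->
  (0 < gmass (invmx S) < +oo)%E /\
  forall y, mvnormal_pdf a S y = gpdf (invmx S) (y - a).
Proof.
rewrite /mvnormal_pdf; set K := _^-1 => K1.
have : (K%:E * gmass (invmx S) = 1)%E.
  rewrite -K1 -(integral_gexp _ a) -ge0_integralZl//.
  - by apply/measurable_EFinP; exact: measurable_gexp.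
  - by move=> x _; rewrite lee_fin ltW// gexp_gt0.
  - by rewrite lee_fin invr_ge0 sqrtr_ge0.
move=> KM; have : (0 <= gmass (invmx S))%E.
  by apply: integral_ge0 => x _; rewrite lee_fin ltW// gexp_gt0.
have K0 : 0 < K.
  rewrite lt_neqAle invr_ge0 sqrtr_ge0 andbT; apply: contra_eq_neq KM => <-.
  by rewrite mul0e eq_sym onee_neq0.
rewrite /gpdf; move: KM; case: (gmass (invmx S)) => [M| |]//=; last first.
  by rewrite gt0_muley ?lte_fin.
rewrite -EFinM => -[KM] M0; rewrite lee_fin in M0.
have M1 : M != 0.
  by apply: contra_eq_neq KM => ->; rewrite mulr0 eq_sym oner_neq0.
split; first by rewrite lte_fin ltry lt_neqAle eq_sym M1 M0.
by move=> y; rewrite mulrC; congr (_ * _); apply: (mulIf M1); rewrite KM mulVf.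
Qed.

(** Prior and likelihood are exponentials of quadratic functions, so their
    product is one too; its constant factor cancels in the quotient. *)
Lemma bayes_density_gpdf a S L v (A := L + invmx S)
    (c := invmx A *m (v + invmx S *m a)) y :
  (\int[lam]_x (mvnormal_pdf a S (vec x))%:E = 1)%E ->
  S^T = S -> A^T = A -> A \in unitmx -> (0 < gmass A < +oo)%E ->
  bayes_density (mvnormal_pdf a S) (likelihood v L) y = gpdf A (y - c).
Proof.
move=> pdf1 sS sA uA mA; have [mS pdfE] := mvnormal_gpdf pdf1.
have sS' := invmx_sym sS.
have Ac : A *m c = v + invmx S *m a by rewrite mulKVmx.
pose e := expR (2^-1 * dot (v + invmx S *m a) c - 2^-1 * dot a (invmx S *m a)) /
          fine (gmass (invmx S)).
have e0 : e != 0.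
  by apply/lt0r_neq0/divr_gt0; [exact: expR_gt0|exact: fine_gt0].
have plE x : mvnormal_pdf a S x * likelihood v L x = e * gexp A (x - c).
  rewrite pdfE /gpdf /e mulrAC [RHS]mulrAC; congr (_ / _).
  rewrite -!expRD; congr expR; rewrite [RHS]addrAC.
  rewrite [X in _ = X + _]addrC -complete_square// mulmxBr.
  rewrite !(dotDl, dotDr, dotNl, dotNr).
  rewrite (dot_sym a x sS') /A mulmxDl dotDr (dotC v x) (dotC (invmx S *m a) x).
  by field.
rewrite /bayes_density plE /gpdf.
have -> : \int[lam]_x (mvnormal_pdf a S (vec x) * likelihood v L (vec x)) =
    e * fine (gmass A).
  rewrite /Rintegral; under eq_integral do rewrite plE EFinM.
  rewrite ge0_integralZl//.
  - rewrite integral_gexp.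
    by case/andP: mA => A0 Aoo; rewrite fineM// gt0_fin_numE.
  - by apply/measurable_EFinP; exact: measurable_gexp.
  - by move=> x _; rewrite lee_fin ltW// gexp_gt0.
  - by rewrite lee_fin ltW// divr_gt0 ?expR_gt0 ?fine_gt0.
by rewrite -mulf_div divff// mul1r.
Qed.

Lemma measurable_slab (i : 'I_k) (r s : R) :
  measurable [set x : Rtuple k R | r < vec x i ord0 <= s].
Proof.
have mi : measurable_fun setT (fun x : Rtuple k R => vec x i ord0).
  exact: mcoord_vec.
rewrite (_ : [set x | _] = (fun x : Rtuple k R => vec x i ord0) @^-1` `]r, s]).
  by rewrite -[X in measurable X]setTI; exact: mi.
by apply/seteqP; split=> x /=; rewrite in_itv.
Qed.

(** Countably many translates of a slab cover the space, and they all have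
    the same measure. *)
Lemma lebesgue_slab_neq0 (i : 'I_k) (r s : R) : lam setT != 0%E -> r < s ->
  lam [set x | r < vec x i ord0 <= s] != 0%E.
Proof.
move=> lamT rs; apply: contra_neq lamT; set N := [set x | _] => N0.
have mN : measurable N by exact: measurable_slab.
pose c (n : nat) : 'cV[R]_k :=
  \col_(j < k) ((odflt 0 (unpickle n : option int))%:~R * (s - r)).
have NT : setT `<=` \bigcup_n (tshift (c n) @^-1` N).
  move=> x _; have d0 : 0 < s - r by rewrite subr_gt0.
  exists (pickle (Num.floor ((s - vec x i ord0) / (s - r)))) => //.
  rewrite /preimage /N /mkset /tshift unvecK !mxE pickleK /=.
  set u := tnth x i; set q := (s - u) / (s - r).
  have := floor_itv q.
  rewrite -(ler_pM2r d0) -(ltr_pM2r d0) /q divfK ?gt_eqF// intrD mulrDl.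
  by move=> /andP[]; lra.
apply/negligibleP => //; apply: negligibleS NT _.
apply: negligible_bigcup => n; apply/negligibleP.
  by rewrite -[X in measurable X]setTI; exact: measurable_tshift.
exact: etrans (lebesgue_tuple_tshift _ mN) N0.
Qed.

End gaussian.
(** * Moments from the moment generating function *)

Section mgf.
Context {R : realType}.

(** For |s| <= 1 each term of order at least 3 in the series of exp (s x) is
    at most |s|^3 times the corresponding term of exp |x|. The bound separates
    [s] from [x], so it can be integrated in [x]. *)
Lemma expR_taylor2 (s x : R) : `|s| <= 1 ->
  `|expR (s * x) - (1 + s * x + 2^-1 * (s * x) ^+ 2)| <= `|s| ^+ 3 * expR `|x|.
Proof.
move=> s1.
pose u n := series (exp_coeff (s * x)) (n + 3)%N -
  (1 + s * x + 2^-1 * (s * x) ^+ 2).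
have u_cvg : u @ \oo --> expR (s * x) - (1 + s * x + 2^-1 * (s * x) ^+ 2).
  apply: cvgB; last exact: cvg_cst.
  rewrite (cvg_shiftn 3 (series (exp_coeff (s * x)))).
  exact: is_cvg_series_exp_coeff.
have u_le n : `|u n| <= `|s| ^+ 3 * expR `|x|.
  have -> : u n = \sum_(3 <= i < (n + 3)%N) exp_coeff (s * x) i.
    rewrite /u seriesEnat /= (big_cat_nat _ (n := 3)) ?leq_addl//= /exp_coeff/=.
    rewrite [X in X + _ - _](_ : _ = 1 + s * x + 2^-1 * (s * x) ^+ 2).
      by rewrite addrAC subrr add0r.
    by rewrite !big_nat_recr//= big_geq//= !factS fact0/=; field.
  apply: le_trans (ler_norm_sum _ _ _) _.
  apply: (@le_trans _ _
    (\sum_(3 <= i < (n + 3)%N) `|s| ^+ 3 * exp_coeff `|x| i)).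
    apply: ler_sum_nat => i /andP[i3 _]; rewrite /exp_coeff/=.
    rewrite normrM normrX (normrM s) exprMn (ger0_norm (x := _^-1)) ?invr_ge0//.
    rewrite [leRHS]mulrA.
    rewrite ler_wpM2r ?invr_ge0// ler_wpM2r ?exprn_ge0//.
    by rewrite ler_wiXn2l.
  rewrite -big_distrr/= ler_wpM2l ?exprn_ge0//.
  apply: (@le_trans _ _ (series (exp_coeff `|x|) (n + 3)%N)).
    rewrite seriesEnat /= [leRHS](big_cat_nat _ (n := 3)) ?leq_addl//= lerDr.
    by apply: sumr_ge0 => i _; exact: exp_coeff_ge0.
  apply: nondecreasing_cvgn_le; last exact: is_cvg_series_exp_coeff.
  by apply: nondecreasing_series => i _ _; exact: exp_coeff_ge0.
have /cvg_norm nu_cvg := u_cvg.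
rewrite -(cvg_lim _ nu_cvg)//; apply: limr_le.
  by apply/cvg_ex; eexists; exact: nu_cvg.
by apply: nearW => n; exact: u_le.
Qed.

Let le_linear_eq0 (a C : R) :
  (forall s : R, 0 < s <= 1 -> `|a| <= C * s) -> a = 0.
Proof.
move=> aC; apply/eqP; apply: contraT => a0.
have a1 : 0 < `|a| by rewrite normr_gt0.
have C0 : `|a| <= C by rewrite -[C]mulr1 aC// ltr01 lexx.
pose s := `|a| / (2 * C).
have sC : s * (2 * C) = `|a| by rewrite /s divfK//; apply: lt0r_neq0; lra.
have s0 : 0 < s by rewrite divr_gt0//; lra.
have := aC s; rewrite s0/= => /(_ _) h.
have : `|a| <= C * s by apply: h; rewrite ler_pdivrMr; lra.
lra.
Qed.

Section moments.
Context d (Omega : measurableType d) (P : probability Omega R).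
Variable X : Omega -> R.
Hypothesis mX : measurable_fun setT X.

Lemma exp_integrable_moments :
  P.-integrable setT (fun w => (expR (X w))%:E) ->
  P.-integrable setT (fun w => (expR (- X w))%:E) ->
  [/\ P.-integrable setT (fun w => (X w)%:E),
      P.-integrable setT (fun w => (X w ^+ 2)%:E) &
      P.-integrable setT (fun w => (expR `|X w|)%:E)].
Proof.
move=> eX eNX.
have e2 : P.-integrable setT (fun w => (expR (X w) + expR (- X w))%:E).
  exact: (integrableD measurableT eX eNX).
have e8 : P.-integrable setT (fun w => (4 * (expR (X w) + expR (- X w)))%:E).
  exact: (integrableZl measurableT 4 e2).
have expn_le (x : R) : expR `|x| <= expR x + expR (- x).
  have [x0|x0] := leP 0 x.
    by rewrite ger0_norm// lerDl expR_ge0.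
  by rewrite ltr0_norm// lerDr expR_ge0.
have le_expn (x : R) : `|x| <= expR `|x|.
  by apply: le_trans (expR_ge1Dx _); rewrite lerDr.
(* from 1 + y <= exp y at y = |x| / 2, squared *)
have sqr_le (x : R) : x ^+ 2 <= 4 * expR `|x|.
  have -> : expR `|x| = expR (`|x| / 2) ^+ 2.
    by rewrite -expRM_natl; congr expR; field.
  have := expR_ge1Dx (`|x| / 2); rewrite -[x ^+ 2]ger0_norm ?sqr_ge0// normrX.
  have := normr_ge0 x; nra.
split.
- apply: le_integrable e2 => //; first exact/measurable_EFinP.
  move=> w _; rewrite lee_fin [leRHS]ger0_norm ?addr_ge0 ?expR_ge0//.
  exact: le_trans (le_expn _) (expn_le _).
- apply: le_integrable e8 => //.
    by apply/measurable_EFinP; apply: measurable_funX.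
  move=> w _; rewrite lee_fin [leRHS]ger0_norm ?mulr_ge0 ?addr_ge0 ?expR_ge0//.
  by rewrite ger0_norm ?sqr_ge0// (le_trans (sqr_le _))// ler_wpM2l.
- apply: le_integrable e2 => //.
    by apply/measurable_EFinP; do 2 apply: measurableT_comp => //.
  move=> w _; rewrite lee_fin [leRHS]ger0_norm ?addr_ge0 ?expR_ge0//.
  by rewrite ger0_norm ?expR_ge0 ?expn_le.
Qed.

(** Both sides of the hypothesis agree with their second order expansions in
    s up to O(s^3), so the coefficients of s and s^2 agree. *)
Lemma gaussian_moments (q : R) :
  (forall s : R, \int[P]_w (expR (s * X w))%:E =
     (expR (2^-1 * (s ^+ 2 * q)))%:E)%E ->
  [/\ P.-integrable setT (fun w => (X w)%:E),
      P.-integrable setT (fun w => (X w ^+ 2)%:E),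
      \int[P]_w X w = 0 &
      \int[P]_w (X w ^+ 2) = q].
Proof.
move=> mgfX.
have iE s : P.-integrable setT (fun w => (expR (s * X w))%:E).
  apply/integrableP; split.
    apply/measurable_EFinP; apply: measurableT_comp => //.
    exact: measurable_funM.
  under eq_integral do rewrite /= ger0_norm ?expR_ge0//.
  by rewrite mgfX ltry.
have [||iX iX2 ieX] := exp_integrable_moments.
- by have := iE 1; under eq_fun do rewrite mul1r.
- by have := iE (-1); under eq_fun do rewrite mulN1r.
pose m1 := \int[P]_w X w; pose m2 := \int[P]_w (X w ^+ 2).
pose C := \int[P]_w (expR `|X w|).
have C0 : 0 <= C by apply: Rintegral_ge0 => w _; exact: expR_ge0.
have i1 : P.-integrable setT (fun w => (1 : R)%:E).
  exact: finite_measure_integrable_cst.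
have isX s : P.-integrable setT (fun w => (s * X w)%:E).
  exact: (integrableZl measurableT s iX).
have isX2 s : P.-integrable setT (fun w => (2^-1 * (s * X w) ^+ 2)%:E).
  have := integrableZl measurableT (2^-1 * s ^+ 2) iX2.
  by apply: eq_integrable => // w _ /=; rewrite -EFinM exprMn -mulrA.
have i1sX s : P.-integrable setT (fun w => (1 + s * X w)%:E).
  exact: (integrableD measurableT i1 (isX s)).
have iT s : P.-integrable setT
    (fun w => (1 + s * X w + 2^-1 * (s * X w) ^+ 2)%:E).
  exact: (integrableD measurableT (i1sX s) (isX2 s)).
have taylorX (s : R) : `|s| <= 1 ->
    `|expR (2^-1 * (s ^+ 2 * q)) - (1 + s * m1 + 2^-1 * (s ^+ 2 * m2))| <=
    `|s| ^+ 3 * C.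
  move=> s1.
  have -> : expR (2^-1 * (s ^+ 2 * q)) - (1 + s * m1 + 2^-1 * (s ^+ 2 * m2)) =
      \int[P]_w (expR (s * X w) - (1 + s * X w + 2^-1 * (s * X w) ^+ 2)).
    rewrite (RintegralB measurableT (iE s) (iT s)); congr (_ - _).
      by rewrite /Rintegral mgfX.
    rewrite (RintegralD measurableT (i1sX s) (isX2 s)).
    rewrite (RintegralD measurableT i1 (isX s)) Rintegral_cst//.
    rewrite (RintegralZl s measurableT iX).
    rewrite [X in fine X](probability_setT P) mulr1; congr (_ + _).
    rewrite mulrA -(RintegralZl (2^-1 * s ^+ 2) measurableT iX2).
    by apply: eq_Rintegral => w _; rewrite exprMn -mulrA.
  have iB : P.-integrable setT (EFin \o (fun w =>
      expR (s * X w) - (1 + s * X w + 2^-1 * (s * X w) ^+ 2))).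
    exact: (integrableB measurableT (iE s) (iT s)).
  apply: le_trans (le_normr_Rintegral measurableT iB) _.
  rewrite -(RintegralZl (`|s| ^+ 3) measurableT ieX); apply: le_Rintegral => //.
  - exact: integrable_norm iB.
  - exact: (integrableZl measurableT _ ieX).
  - by move=> w _; exact: expR_taylor2.
pose C' := C + 2^-1 * (2^-1 * q) ^+ 2 + expR `|2^-1 * q|.
have e0 : 0 <= expR `|2^-1 * q| by exact: expR_ge0.
have main (s : R) : `|s| <= 1 ->
    `|s * m1 + s ^+ 2 * (2^-1 * (m2 - q))| <= C' * `|s| ^+ 3.
  move=> s1; have s21 : `|s ^+ 2| <= 1 by rewrite normrX exprn_ile1.
  have n1 k : `|s| ^+ (k + 3) <= `|s| ^+ 3.
    by rewrite ler_wiXn2l ?leq_addl.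
  have := expR_taylor2 (2^-1 * q) s21; have := taylorX _ s1.
  rewrite mulrCA; set E := expR (s ^+ 2 * _) => h1 h2.
  have h6 : `|s ^+ 2| ^+ 3 * expR `|2^-1 * q| <= `|s| ^+ 3 * expR `|2^-1 * q|.
    by rewrite ler_wpM2r// normrX -exprM (n1 3).
  have h4 : 2^-1 * (s ^+ 2 * (2^-1 * q)) ^+ 2 <=
      `|s| ^+ 3 * (2^-1 * (2^-1 * q) ^+ 2).
    have u0 := sqr_ge0 (2^-1 * q).
    rewrite exprMn mulrCA ler_wpM2r//; first by rewrite mulr_ge0.
    rewrite -exprM.
    by rewrite -[X in X <= _]ger0_norm ?exprn_even_ge0// normrX (n1 1).
  have h4' : 0 <= 2^-1 * (s ^+ 2 * (2^-1 * q)) ^+ 2.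
    by rewrite mulr_ge0 ?sqr_ge0.
  move: h1 h2; rewrite !ler_norml /C' => /andP[h1 h1'] /andP[h2 h2'].
  by apply/andP; split; lra.
have bound (s : R) : 0 < s <= 1 ->
    `|m1| <= C' * s ^+ 2 /\ `|2^-1 * (m2 - q)| <= C' * s.
  move=> /andP[s0 s1]; have := main s; have := main (- s).
  rewrite normrN sqrrN (ger0_norm (ltW s0)) => /(_ s1) + /(_ s1).
  rewrite !ler_norml => /andP[h1 h2] /andP[h3 h4].
  have C1 : s * (C' * s ^+ 2) = C' * s ^+ 3 by ring.
  have C2 : s ^+ 2 * (C' * s) = C' * s ^+ 3 by ring.
  have s20 : 0 < s ^+ 2 by rewrite exprn_gt0.
  set X2 := 2^-1 * _ in h1 h2 h3 h4 *.
  rewrite -(ler_pM2l s0 _ m1) -(ler_pM2l s0 m1) mulrN C1.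
  rewrite -(ler_pM2l s20 _ X2) -(ler_pM2l s20 X2) mulrN C2.
  by split; apply/andP; split; lra.
have m10 : m1 = 0.
  apply: (@le_linear_eq0 _ C') => s s01; have [+ _] := bound s s01.
  have C'0 : 0 <= C' by rewrite !addr_ge0// mulr_ge0 ?sqr_ge0.
  move=> /le_trans; apply; apply: ler_wpM2l => //.
  by case/andP: s01 => s0 s1; rewrite expr2 ler_piMl// ltW.
have : 2^-1 * (m2 - q) = 0.
  by apply: (@le_linear_eq0 _ C') => s s01; have [] := bound s s01.
by move=> m2q; split=> //; rewrite -/m2; lra.
Qed.

End moments.
End mgf.
(** * Conditional expectations given a generated sigma-algebra *)

(** The values of [phi] at the rationals determine the inverse through a
    countable supremum, hence its measurability. *)
Lemma measurable_left_inverse (R : realType) (phi : R -> R) :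
  {homo phi : x y / x < y} ->
  exists2 psi : R -> R, measurable_fun setT psi & cancel phi psi.
Proof.
move=> phi_lt; pose q n : R := ratr (odflt 0 (unpickle n : option rat)).
pose u n (y : R) : \bar R := if phi (q n) < y then (q n)%:E else -oo%E.
exists (fun y => fine (esups (u ^~ y) 0%N)).
  apply: measurableT_comp => //; apply: measurable_fun_esups => n.
  apply: measurable_fun_if => //; exact: measurable_fun_ltr.
move=> x; rewrite (_ : esups _ 0%N = x%:E)//.
have phiE a b : (phi a < phi b) = (a < b).
  apply/idP/idP => [|/phi_lt//]; apply: contraTT; rewrite -!leNgt le_eqVlt.
  by move=> /predU1P[->|/phi_lt/ltW].
have uE n : u n (phi x) = if q n < x then (q n)%:E else -oo%E.
  by rewrite /u phiE.
apply/eqP; rewrite eq_le; apply/andP; split.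
  apply: ge_ereal_sup => _ [n _ <-]; rewrite uE.
  by case: ifPn => [/ltW|_]; rewrite ?lee_fin ?leNye.
rewrite leNgt; apply/negP => sx.
have q_le p : ratr p < x -> ((ratr p)%:E <= esups (u ^~ (phi x)) 0%N)%E.
  move=> px; apply: ereal_sup_ubound; exists (pickle p) => //.
  by rewrite uE /q pickleK /= px.
move: sx q_le; case: (esups _ _) => [r| |] //.
  rewrite lte_fin => /rat_in_itvoo[p]; rewrite in_itv/= => /andP[rp px].
  by move=> /(_ p px); rewrite lee_fin leNgt rp.
have : x - 1 < x by rewrite ltrBlDr ltrDl.
move=> /rat_in_itvoo[p]; rewrite in_itv/= => /andP[_ px] _ /(_ p px).
by rewrite leeNy_eq.
Qed.

Section sub_sigma_algebra.
Context d (Omega : measurableType d) {R : realType} (P : probability Omega R).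
Variable C : set (set Omega).
Hypothesis CO : <<s C >> `<=` @measurable _ Omega.
Local Notation F := <<s C >>.
(* Omega with the sigma-algebra F, so that measurability with respect to F is
   measurability on this type *)
Local Notation OmegaF := (g_sigma_algebraType C).

Lemma measurable_sub_id : measurable_fun setT (idfun : Omega -> OmegaF).
Proof. by move=> _ A mA; rewrite setTI; exact: CO. Qed.

Lemma measurable_wrtP (Y : Omega -> R) :
  measurable_wrt F Y <-> measurable_fun setT (Y : OmegaF -> R).
Proof.
split=> [mY _ A mA|mY A mA]; first by rewrite setTI; exact: mY.
by have := mY measurableT A mA; rewrite setTI.
Qed.

Lemma measurable_sub d' (T : measurableType d') (Y : Omega -> T) :
  measurable_fun setT (Y : OmegaF -> T) -> measurable_fun setT Y.
Proof.
by move=> mY _ A mA; rewrite setTI; apply: CO;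
  have := mY measurableT A mA; rewrite setTI.
Qed.

Lemma measurable_wrt_sub (Y : Omega -> R) :
  measurable_wrt F Y -> measurable_fun setT Y.
Proof. by move=> /measurable_wrtP mY; exact: (measurable_sub mY). Qed.

Definition sub_prob : probability OmegaF R :=
  distribution P (HB.pack_for {mfun Omega >-> OmegaF} (idfun : Omega -> OmegaF)
    (isMeasurableFun.Build _ _ _ _ _ measurable_sub_id)).

Lemma integrable_sub (Y : Omega -> \bar R) :
  measurable_fun setT (Y : OmegaF -> \bar R) -> P.-integrable setT Y ->
  sub_prob.-integrable setT Y.
Proof.
by move=> mY iY; exact: (integrable_pushforward measurable_sub_id mY).
Qed.

Lemma integral_sub (Y : Omega -> \bar R) G :
  F G -> measurable_fun setT (Y : OmegaF -> \bar R) -> P.-integrable setT Y ->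
  (\int[sub_prob]_(w in G) Y w = \int[P]_(w in G) Y w)%E.
Proof.
move=> FG mY iY; apply: (integral_pushforward measurable_sub_id mY) => //.
by apply: integrableS iY => //; exact: CO.
Qed.

Lemma ge0_integral_sub (Y : Omega -> \bar R) G :
  F G -> measurable_fun setT (Y : OmegaF -> \bar R) -> (forall w, 0 <= Y w)%E ->
  (\int[sub_prob]_(w in G) Y w = \int[P]_(w in G) Y w)%E.
Proof.
move=> FG mY Y0; apply: (ge0_integral_pushforward measurable_sub_id) => //.
exact: measurable_funTS.
Qed.

Lemma cond_exp_unique (X Y Z : Omega -> R) :
  is_cond_exp P F X Y -> is_cond_exp P F X Z -> {ae P, forall w, Y w = Z w}.
Proof.
move=> [_ iY /measurable_wrtP mY YX] [_ iZ /measurable_wrtP mZ ZX].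
have /measurable_EFinP mY' := mY; have /measurable_EFinP mZ' := mZ.
have : ae_eq sub_prob setT (EFin \o Y) (EFin \o Z).
  apply: integral_ae_eq => //; first exact: integrable_sub.
  by move=> E _ FE; rewrite !integral_sub// YX// ZX.
move=> [N [FN N0 YZ]]; exists N; split=> //; first exact: CO.
by move=> w /= YZw; apply: YZ => /= /(_ Logic.I) [].
Qed.

Lemma ae_eq_integrable (Y Z : Omega -> R) :
  P.-integrable setT (EFin \o Y) -> measurable_fun setT Z ->
  {ae P, forall w, Y w = Z w} ->
  P.-integrable setT (EFin \o Z) /\
  forall G, measurable G ->
    (\int[P]_(w in G) (Z w)%:E = \int[P]_(w in G) (Y w)%:E)%E.
Proof.
move=> iY mZ YZ.
have mY : measurable_fun setT Y.
  by apply/measurable_EFinP; exact: measurable_int iY.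
have YZE : {ae P, forall w, setT w -> (EFin \o Y) w = (EFin \o Z) w}.
  by apply: filterS YZ => w /= ->.
split; last first.
  move=> G mG; apply/esym/ae_eq_integral => //.
  - exact/measurable_funTS/measurable_EFinP.
  - exact/measurable_funTS/measurable_EFinP.
  - exact: (@ae_eq_subset _ _ _ _ P setT).
move/integrableP: iY => [_ Yoo]; apply/integrableP; split.
  exact/measurable_EFinP.
apply: le_lt_trans Yoo; rewrite le_eqVlt; apply/orP; left; apply/eqP.
apply: ae_eq_integral => //; try exact/measurableT_comp/measurable_EFinP.
by apply: filterS YZ => w /= ->.
Qed.

Lemma is_cond_exp_ae (X Y Z : Omega -> R) :
  is_cond_exp P F X Y -> measurable_wrt F Z -> {ae P, forall w, Y w = Z w} ->
  is_cond_exp P F X Z.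
Proof.
move=> [iX iY mY YX] mZ YZ.
have [iZ EZ] := ae_eq_integrable iY (measurable_wrt_sub mZ) YZ.
by split=> // G FG; rewrite EZ ?YX//; exact: CO.
Qed.

Lemma is_cond_exp_aeX (X X' Y : Omega -> R) :
  is_cond_exp P F X Y -> measurable_fun setT X' ->
  {ae P, forall w, X w = X' w} -> is_cond_exp P F X' Y.
Proof.
move=> [iX iY mY YX] mX' XX'; have [iX' EX'] := ae_eq_integrable iX mX' XX'.
by split=> // G FG; rewrite YX// EX'//; exact: CO.
Qed.

End sub_sigma_algebra.
(** * Conditional laws that are translates of one law *)

Section location.
Context d (Omega : measurableType d) {R : realType} (P : probability Omega R).
Variable C : set (set Omega).
Hypothesis CO : <<s C >> `<=` @measurable _ Omega.
Local Notation F := <<s C >>.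
Local Notation OmegaF := (g_sigma_algebraType C).
Local Notation PF := (sub_prob P CO).
Context {k : nat}.
Variables (gam : probability (Rtuple k R) R) (Theta mu : Omega -> 'cV[R]_k).
Hypothesis mTheta : mcoord Theta.
(* Given F, the vector Theta is distributed as mu plus a vector of law gam. *)
Hypothesis Theta_cond : forall B, measurable B ->
  cond_exp_eq P F (fun w => \1_B (unvec (Theta w)))
    (fun w => fine (gam (tshift (mu w) @^-1` B))).

Let gam_fin B : measurable B -> gam B = (fine (gam B))%:E.
Proof. by move=> mB; rewrite fineK// fin_num_measure. Qed.

Let mpre (y : 'cV[R]_k) B : measurable B -> measurable (tshift y @^-1` B).
Proof.
by move=> mB; rewrite -[X in measurable X]setTI; exact: measurable_tshift.
Qed.

(** The conditional probability of the half space x_i > 0 is a function of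
    mu_i alone, strictly increasing because slabs have positive mass. Hence
    mu_i is a measurable function of that probability, which has an
    F-measurable version. *)
Lemma cond_location_version :
  (forall (i : 'I_k) (r s : R), r < s ->
     gam [set x | r < vec x i ord0 <= s] != 0%E) ->
  exists2 Y : Omega -> 'cV[R]_k, mcoord (Y : OmegaF -> 'cV[R]_k) &
    {ae P, forall w, Y w = mu w}.
Proof.
move=> slab.
have mvi i : measurable_fun setT (fun x : Rtuple k R => vec x i ord0).
  exact: mcoord_vec.
have mhalf i (r : R) : measurable [set x : Rtuple k R | - r < vec x i ord0].
  rewrite (_ : [set x | _] =
      (fun x : Rtuple k R => vec x i ord0) @^-1` `](- r), +oo[).
    by rewrite -[X in measurable X]setTI; exact: mvi.
  by apply/seteqP; split=> x /=; rewrite in_itv/= andbT.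
pose phi i (r : R) : R := fine (gam [set x | - r < vec x i ord0]).
have phi_lt i : {homo phi i : x y / x < y}.
  move=> r s rs; rewrite -lte_fin -!gam_fin//.
  set N := [set x : Rtuple k R | - s < vec x i ord0 <= - r].
  have -> : [set x : Rtuple k R | - s < vec x i ord0] =
      [set x | - r < vec x i ord0] `|` N.
    apply/seteqP; split=> x /=; rewrite /N /mkset; last first.
      by case=> [|/andP[]//]; apply: lt_trans; rewrite ltrN2.
    by move=> sx; case: (ltP (- r) (vec x i ord0)) => rx;
      [left|right; rewrite sx].
  have mN : measurable N by exact: measurable_slab.
  rewrite measureU//; last first.
    by apply/seteqP; split=> x //= [/lt_le_trans h /andP[_ /h]]; rewrite ltxx.
  rewrite -[X in (X < _)%E]adde0 lteD2lE ?fin_num_measure//.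
  by rewrite lt_neqAle eq_sym slab ?ltrN2//=.
have ex i : {Yi : Omega -> R | measurable_fun setT (Yi : OmegaF -> R) /\
    {ae P, forall w, Yi w = mu w i ord0}}.
  apply: cid.
  have [psi mpsi psiK] := measurable_left_inverse (phi_lt i).
  have m0 := mhalf i 0.
  have [Y1 [_ _ /measurable_wrtP mY1 _] Y1E] := Theta_cond m0.
  exists (psi \o Y1); split; first exact: measurableT_comp.
  apply: filterS Y1E => w /= ->; rewrite -[RHS]psiK; congr psi.
  congr (fine (gam _)); apply/funext => x; apply/propext.
  rewrite /preimage /mkset /tshift unvecK oppr0.
  by rewrite [X in 0 < X]mxE -ltrBlDr sub0r.
exists (fun w => \col_i sval (ex i) w).
  move=> i; rewrite (_ : (fun _ => _) = (sval (ex i))).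
    by have [] := svalP (ex i).
  by apply/funext => w; rewrite mxE.
have : {ae P, forall w, forall i, sval (ex i) w = mu w i ord0}.
  by apply: filter_forall => i; have [] := svalP (ex i).
by apply: filterS => w Yw; apply/colP => i; rewrite mxE.
Qed.

Variable Y : Omega -> 'cV[R]_k.
Hypotheses (mY : mcoord (Y : OmegaF -> 'cV[R]_k))
  (YE : {ae P, forall w, Y w = mu w}).

(* The shear by 1 carries the product of P on F and gam to the joint law of F
   and Theta; the shear by -1 is its inverse. *)
Let shear (s : R) (p : OmegaF * Rtuple k R) : OmegaF * Rtuple k R :=
  (p.1, tshift (s *: Y p.1) p.2).

Let measurable_shear s : measurable_fun setT (shear s).
Proof.
apply: measurable_fun_pair => //; apply: measurable_unvec; apply: mcoordD.
  exact: mcoord_vec.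
move=> i; rewrite (_ : (fun _ => _) =
    (fun p : OmegaF * Rtuple k R => s * Y p.1 i ord0)).
  apply: measurable_funM => //.
  exact: (measurableT_comp (mY i) measurable_fst).
by apply/funext => p; rewrite mxE.
Qed.

Let joint (w : Omega) : OmegaF * Rtuple k R := (w, unvec (Theta w)).

Let measurable_joint : measurable_fun setT joint.
Proof.
apply: measurable_fun_pair; first exact: measurable_sub_id.
exact: measurable_unvec.
Qed.

Let joint_law : {measure set (OmegaF * Rtuple k R) -> \bar R} :=
  measure_function_pushforward__canonical__measure_function_Measure P
    measurable_joint.

Let shear_law : {measure set (OmegaF * Rtuple k R) -> \bar R} :=
  measure_function_pushforward__canonical__measure_function_Measure
    (PF \x gam)%E (measurable_shear 1).

Let measurable_gam_tshift B : measurable B ->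
  measurable_fun setT
    ((fun w => gam (tshift (Y w) @^-1` B)) : OmegaF -> \bar R).
Proof.
move=> mB.
have mE : measurable (shear 1 @^-1` (setT `*` B)).
  rewrite -[X in measurable X]setTI; apply: measurable_shear => //.
  exact: measurableX.
have := measurable_fun_xsection gam mE.
rewrite (_ : _ \o _ = (fun w => gam (tshift (Y w) @^-1` B)))//.
apply/funext => w /=; congr (gam _); apply/seteqP; split=> x.
  by rewrite /xsection /= inE /shear /= scale1r => -[].
by rewrite /xsection /= inE /shear /= scale1r.
Qed.

Let joint_law_rect G B : F G -> measurable B ->
  joint_law (G `*` B) = shear_law (G `*` B).
Proof.
move=> FG mB; have mG := CO FG.
have mI : measurable_fun setT (fun w => \1_B (unvec (Theta w)) : R).
  apply: (@measurableT_comp _ _ _ _ _ _ (\1_B : Rtuple k R -> R)).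
    exact: measurable_indic.
  exact: measurable_unvec.
transitivity (\int[P]_(w in G) gam (tshift (Y w) @^-1` B))%E.
  transitivity (\int[P]_(w in G) (\1_B (unvec (Theta w)))%:E)%E.
    rewrite (_ : joint_law _ = P ((fun w => unvec (Theta w)) @^-1` B `&` G)).
      have mB' : measurable ((fun w => unvec (Theta w)) @^-1` B).
        by rewrite -[X in measurable X]setTI; exact: measurable_unvec.
      by rewrite -integral_indic.
    by congr (P _); apply/seteqP; split=> w [].
  have [V [_ iV mV VE] Vae] := Theta_cond mB.
  rewrite -VE//; apply: ae_eq_integral => //.
  - apply/measurable_funTS/measurable_EFinP.
    exact: (measurable_wrt_sub CO mV).
  - by apply: measurable_funTS; apply: (measurable_sub CO);
      exact: measurable_gam_tshift.
  - apply: filterS2 Vae YE => w /= -> -> _.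
    by rewrite -gam_fin//; exact: mpre.
have mR : measurable (shear 1 @^-1` (G `*` B)).
  rewrite -[X in measurable X]setTI; apply: measurable_shear => //.
  exact: measurableX.
rewrite [RHS](_ : _ =
  \int[PF]_w (gam \o xsection (shear 1 @^-1` (G `*` B))) w)%E//.
rewrite -(ge0_integral_sub P CO FG (measurable_gam_tshift mB))//.
rewrite integral_mkcond; apply: eq_integral => w _.
rewrite patchE /=; case: ifPn => [/set_mem Gw|]; last first.
  move=> /negP; rewrite inE => Gw.
  rewrite (_ : xsection _ _ = set0) ?measure0//.
  by apply/seteqP; split=> x //; rewrite /xsection /= inE => -[].
congr (gam _); apply/seteqP; split=> x;
  rewrite /xsection /= inE /shear /= scale1r//.
by case.
Qed.

Let joint_lawE E : measurable E -> joint_law E = shear_law E.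
Proof.
pose rect : set (set (OmegaF * Rtuple k R)) :=
  [set E | exists2 G, F G & exists2 B, measurable B & E = G `*` B].
apply: (measure_unique rect (fun=> setT)).
- rewrite measurable_prod_measurableType; congr (<<s _ >>).
  apply/seteqP; split=> [_ [G mG [B mB <-]]|_ [G mG [B mB ->]]].
    by exists G => //; exists B.
  by exists G => //; exists B.
- move=> _ _ [G1 mG1 [B1 mB1 ->]] [G2 mG2 [B2 mB2 ->]].
  rewrite -setXI; exists (G1 `&` G2).
    exact: (@measurableI _ OmegaF).
  by exists (B1 `&` B2) => //; exact: measurableI.
- move=> _; exists setT; first exact: (@measurableT _ OmegaF).
  by exists setT => //; rewrite setXTT.
- by rewrite bigcup_const.
- by move=> _ [G FG [B mB ->]]; exact: joint_law_rect.
- move=> _; rewrite /= /pushforward preimage_setT.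
  by rewrite [X in (X < _)%E](probability_setT P) ltry.
Qed.

(** Undoing the shift by [Y] turns the joint law of F and Theta into a
    product: Theta - Y has law gam and is independent of F. *)
Lemma ge0_integral_residual (f : OmegaF * Rtuple k R -> \bar R) :
  measurable_fun setT f -> (forall p, 0 <= f p)%E ->
  (\int[P]_w f (w, unvec (Theta w - Y w)) =
   \int[PF]_w \int[gam]_x f (w, x))%E.
Proof.
move=> mf f0; rewrite -fubini_tonelli1//.
have mN := measurable_shear (-1); have m1 := measurable_shear 1.
have mfN : measurable_fun setT (f \o shear (-1)) by exact: measurableT_comp.
transitivity (\int[P]_(w in joint @^-1` setT) ((f \o shear (-1)) \o joint) w)%E.
  apply: eq_integral => w _.
  by rewrite /= /shear /joint /tshift unvecK scaleN1r.
rewrite -(ge0_integral_pushforward measurable_joint)//; last first.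
  by move=> p _; exact: f0.
rewrite (eq_measure_integral shear_law); last first.
  by move=> E mE _; exact: joint_lawE.
rewrite (ge0_integral_pushforward m1)//; last by move=> p _; exact: f0.
apply: eq_integral => -[w x] _ /=.
by rewrite /shear /tshift /= !unvecK scaleN1r scale1r addrK vecK.
Qed.

End location.
(** * Least squares estimates *)

Section least_squares.
Context d (Omega : measurableType d) {R : realType} (P : probability Omega R).
Variable C : set (set Omega).
Hypothesis CO : <<s C >> `<=` @measurable _ Omega.
Local Notation F := <<s C >>.
Local Notation OmegaF := (g_sigma_algebraType C).
Local Notation PF := (sub_prob P CO).
Context {k : nat}.
Variables (gam : probability (Rtuple k R) R) (V : 'M[R]_k).
Variables (Theta Y : Omega -> 'cV[R]_k).
Hypotheses (mTheta : mcoord Theta) (mY : mcoord (Y : OmegaF -> 'cV[R]_k)).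
(* Theta - Y has law gam and is independent of F. *)
Hypothesis residual : forall f : OmegaF * Rtuple k R -> \bar R,
  measurable_fun setT f -> (forall p, 0 <= f p)%E ->
  (\int[P]_w f (w, unvec (Theta w - Y w)) =
   \int[PF]_w \int[gam]_x f (w, x))%E.
Hypotheses
  (gam1 : forall i, gam.-integrable setT (fun x => (vec x i ord0)%:E))
  (gam2 : forall i j,
     gam.-integrable setT (fun x => (vec x i ord0 * vec x j ord0)%:E))
  (gam_mean : forall i, \int[gam]_x vec x i ord0 = 0)
  (gam_cov : forall i j, \int[gam]_x (vec x i ord0 * vec x j ord0) = V i j).
Hypothesis Theta2 : forall i,
  P.-integrable setT (fun w => (Theta w i ord0 ^+ 2)%:E).

Let mYO : mcoord Y.
Proof. by move=> i; apply: (measurable_sub CO); exact: mY. Qed.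

Let residual_ge0 (g : Rtuple k R -> \bar R) G :
  measurable_fun setT g -> (forall x, 0 <= g x)%E -> F G ->
  (\int[P]_(w in G) g (unvec (Theta w - Y w)) = P G * \int[gam]_x g x)%E.
Proof.
move=> mg g0 FG.
pose f (p : OmegaF * Rtuple k R) : \bar R := ((\1_G p.1)%:E * g p.2)%E.
have mi : measurable_fun setT (\1_G : OmegaF -> R).
  by apply: (@measurable_indic _ OmegaF).
have mf : measurable_fun setT f.
  apply: emeasurable_funM; last exact: (measurableT_comp mg measurable_snd).
  by apply/measurable_EFinP; exact: (measurableT_comp mi measurable_fst).
have f0 p : (0 <= f p)%E by rewrite mule_ge0// lee_fin.
transitivity (\int[P]_w f (w, unvec (Theta w - Y w)))%E.
  rewrite integral_mkcond; apply: eq_integral => w _.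
  by rewrite epatch_indic /f /= muleC.
rewrite residual//.
transitivity (\int[PF]_w ((\1_G w)%:E * \int[gam]_x g x))%E.
  by apply: eq_integral => w _; rewrite /f /= ge0_integralZl.
rewrite ge0_integralZr//=.
- by rewrite integral_indic ?setIT//; exact: (@measurableT _ OmegaF).
- exact/measurable_EFinP.
- by apply: integral_ge0 => x _; exact: g0.
Qed.

(** Any function of the residual has a constant conditional expectation. *)
Lemma residual_integral (g : Rtuple k R -> R) : measurable_fun setT g ->
  gam.-integrable setT (EFin \o g) ->
  P.-integrable setT (fun w => (g (unvec (Theta w - Y w)))%:E) /\
  forall G, F G -> (\int[P]_(w in G) (g (unvec (Theta w - Y w)))%:E =
                    \int[P]_(w in G) (\int[gam]_x g x)%:E)%E.
Proof.
move=> mg ig.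
have mgE : measurable_fun setT (EFin \o g) by exact/measurable_EFinP.
have mZ : measurable_fun setT (fun w => unvec (Theta w - Y w) : Rtuple k R).
  by apply: measurable_unvec; exact: mcoordB.
split.
  apply/integrableP; split; first exact: (measurableT_comp mgE mZ).
  have -> : (\int[P]_w `|(g (unvec (Theta w - Y w)))%:E| =
      P setT * \int[gam]_x `|(g x)%:E|)%E.
    rewrite -residual_ge0//; first exact: measurableT_comp.
    exact: (@measurableT _ OmegaF).
  by rewrite probability_setT mul1e; case/integrableP : ig.
move=> G FG; have mG := CO FG.
have fin_g := integrable_fin_num measurableT ig.
rewrite integral_cst//= fineK// muleC.
have iE (h : Rtuple k R -> \bar R) : measurable_fun setT h ->
    (forall x, 0 <= h x)%E ->
    (\int[P]_(w in G) h (unvec (Theta w - Y w)) = P G * \int[gam]_x h x)%E.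
  by move=> mh h0; exact: residual_ge0.
transitivity (P G * \int[gam]_x (EFin \o g)^\+ x -
              P G * \int[gam]_x (EFin \o g)^\- x)%E.
  rewrite -(iE _ (measurable_funepos mgE))// -(iE _ (measurable_funeneg mgE))//.
  rewrite integralE; congr (_ - _)%E; apply: eq_integral => w _ /=.
    by rewrite !funeposE.
  by rewrite !funenegE.
rewrite -muleBr ?fin_num_measure// -?integralE//.
apply: fin_num_adde_defr; apply: integrable_fin_num => //.
exact: integrable_funepos.
Qed.

Lemma residual_coord i :
  P.-integrable setT (fun w => (Theta w i ord0 - Y w i ord0)%:E) /\
  forall G, F G -> (\int[P]_(w in G) (Theta w i ord0 - Y w i ord0)%:E = 0)%E.
Proof.
have mi : measurable_fun setT (fun x : Rtuple k R => vec x i ord0).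
  exact: mcoord_vec.
have [iZ ZE] := residual_integral mi (gam1 i).
have E w : vec (unvec (Theta w - Y w)) i ord0 = Theta w i ord0 - Y w i ord0.
  by rewrite unvecK !mxE.
split; first by move: iZ; under eq_fun do rewrite E.
by move=> G FG; have := ZE G FG; under eq_integral do rewrite E;
  rewrite gam_mean integral0.
Qed.

Lemma residual_coord2 i j :
  P.-integrable setT (fun w =>
    ((Theta w i ord0 - Y w i ord0) * (Theta w j ord0 - Y w j ord0))%:E) /\
  forall G, F G -> (\int[P]_(w in G)
    ((Theta w i ord0 - Y w i ord0) * (Theta w j ord0 - Y w j ord0))%:E =
    \int[P]_(w in G) (V i j)%:E)%E.
Proof.
have mi : measurable_fun setT
    (fun x : Rtuple k R => vec x i ord0 * vec x j ord0).
  by apply: measurable_funM; exact: mcoord_vec.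
have [iZ ZE] := residual_integral mi (gam2 i j).
have E w :
    vec (unvec (Theta w - Y w)) i ord0 * vec (unvec (Theta w - Y w)) j ord0 =
    (Theta w i ord0 - Y w i ord0) * (Theta w j ord0 - Y w j ord0).
  by rewrite unvecK !mxE.
split; first by move: iZ; under eq_fun do rewrite E.
by move=> G FG; have := ZE G FG; under eq_integral do rewrite E;
  rewrite gam_cov.
Qed.

Let iTheta i : P.-integrable setT (fun w => (Theta w i ord0)%:E).
Proof.
have i1 : P.-integrable setT (fun w => (1 : R)%:E).
  exact: finite_measure_integrable_cst.
apply: le_integrable (integrableD measurableT i1 (Theta2 i)) => //.
  exact/measurable_EFinP.
move=> w _; rewrite -EFinD lee_fin [leRHS]ger0_norm ?addr_ge0 ?sqr_ge0//.
rewrite -[_ ^+ 2]ger0_norm ?sqr_ge0// normrX.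
by set a := `|_|; have := normr_ge0 (Theta w i ord0); rewrite -/a; nra.
Qed.

Lemma cond_mean_location : is_cond_mean P F Theta Y.
Proof.
move=> i; have [iZ Z0] := residual_coord i.
have iY : P.-integrable setT (EFin \o (fun w => Y w i ord0)).
  have := integrableB measurableT (iTheta i) iZ.
  by apply: eq_integrable => // w _; rewrite /= -EFinB opprB addrC subrK.
split; [exact: iTheta|exact: iY|by apply/measurable_wrtP; exact: mY|].
move=> G FG; have mG := CO FG.
have := Z0 G FG; under eq_integral do rewrite EFinB.
have iTG := integrableS measurableT mG (@subsetT _ G) (iTheta i).
have iYG := integrableS measurableT mG (@subsetT _ G) iY.
have fY := integrable_fin_num mG iYG.
have fT := integrable_fin_num mG iTG.
rewrite integralB// => /eqP; rewrite sube_eq ?add0e ?fin_num_adde_defl//.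
by move/eqP.
Qed.

Let mcoord_wrt (W : Omega -> 'cV[R]_k) :
  (forall i, measurable_wrt F (fun w => W w i ord0)) ->
  mcoord (W : OmegaF -> 'cV[R]_k).
Proof. by move=> mW i; apply/measurable_wrtP; exact: mW. Qed.

Let mcoord_sub (W : Omega -> 'cV[R]_k) :
  mcoord (W : OmegaF -> 'cV[R]_k) -> mcoord W.
Proof. by move=> mW i; apply: (measurable_sub CO); exact: mW. Qed.

Let gam_sqnormD (u : 'cV[R]_k) :
  (\int[gam]_x (sqnorm (vec x + u))%:E = (\tr V + sqnorm u)%:E)%E.
Proof.
pose f i (x : Rtuple k R) := vec x i ord0 * vec x i ord0 +
  (2 * u i ord0 * vec x i ord0 + u i ord0 ^+ 2).
have i2 i : gam.-integrable setT (fun x => (2 * u i ord0 * vec x i ord0)%:E).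
  exact: (integrableZl measurableT (2 * u i ord0) (gam1 i)).
have i0 i : gam.-integrable setT (fun=> (u i ord0 ^+ 2)%:E).
  exact: finite_measure_integrable_cst.
have i20 i : gam.-integrable setT
    (fun x => (2 * u i ord0 * vec x i ord0 + u i ord0 ^+ 2)%:E).
  exact: (integrableD measurableT (i2 i) (i0 i)).
have iF i : gam.-integrable setT (fun x => (f i x)%:E).
  exact: (integrableD measurableT (gam2 i i) (i20 i)).
transitivity (\int[gam]_x \sum_i (f i x)%:E)%E.
  apply: eq_integral => x _; rewrite sumEFin sqnormE; congr EFin.
  by apply: eq_bigr => i _; rewrite mxE /f; ring.
rewrite integral_sum// /mxtrace sqnormE -big_split/= -sumEFin.
apply: eq_bigr => i _; rewrite -[LHS]fineK; last exact: integrable_fin_num.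
congr EFin; rewrite -[LHS]/(\int[gam]_x f i x).
rewrite (RintegralD measurableT (gam2 i i) (i20 i)) gam_cov; congr (_ + _).
rewrite (RintegralD measurableT (i2 i) (i0 i)).
rewrite (RintegralZl _ measurableT (gam1 i)) gam_mean mulr0 add0r.
by rewrite Rintegral_cst// [X in fine X](probability_setT gam) mulr1.
Qed.

(** Averaging over the residual first, with the F-measurable vector Y - W kept
    fixed, the cross term vanishes because the residual is centred. Values in
    [0, +oo] are allowed, so that [W] need not be square integrable. *)
Lemma mse_location (W : Omega -> 'cV[R]_k) :
  (forall i, measurable_wrt F (fun w => W w i ord0)) ->
  (\int[P]_w (sqnorm (Theta w - W w))%:E =
   (\tr V)%:E + \int[P]_w (sqnorm (Y w - W w))%:E)%E.
Proof.
move=> /mcoord_wrt mW.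
have mYW : mcoord ((fun w => Y w - W w) : OmegaF -> 'cV[R]_k) by exact: mcoordB.
have mS : measurable_fun setT
    ((fun w => (sqnorm (Y w - W w))%:E) : OmegaF -> \bar R).
  by apply/measurable_EFinP; exact: measurable_dot.
pose f (p : OmegaF * Rtuple k R) := (sqnorm (vec p.2 + (Y p.1 - W p.1)))%:E.
have mf : measurable_fun setT f.
  have mv : mcoord (fun p : OmegaF * Rtuple k R => vec p.2 + (Y p.1 - W p.1)).
    apply: mcoordD; first exact: mcoord_vec.
    by move=> i; exact: (measurableT_comp (mYW i) measurable_fst).
  by apply/measurable_EFinP; exact: measurable_dot.
transitivity (\int[P]_w f (w, unvec (Theta w - Y w)))%E.
  by apply: eq_integral => w _; rewrite /f /= unvecK addrA subrK.
rewrite residual//; last by move=> p; rewrite lee_fin sqnorm_ge0.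
transitivity (\int[PF]_w ((\tr V)%:E + (sqnorm (Y w - W w))%:E))%E.
  by apply: eq_integral => w _; rewrite -EFinD -gam_sqnormD.
have V0 : 0 <= \tr V.
  apply: sumr_ge0 => i _; rewrite -gam_cov; apply: Rintegral_ge0 => x _.
  by rewrite -expr2 sqr_ge0.
rewrite ge0_integralD//; last by move=> w _; rewrite lee_fin sqnorm_ge0.
rewrite integral_cst//= probability_setT mule1; congr (_ + _)%E.
rewrite -(ge0_integral_sub P CO _ mS)//; first exact: (@measurableT _ OmegaF).
by move=> w; rewrite lee_fin sqnorm_ge0.
Qed.

Let mse0 : (\int[P]_w (sqnorm (Theta w - Y w))%:E = (\tr V)%:E)%E.
Proof.
rewrite mse_location; last by move=> i; apply/measurable_wrtP; exact: mY.
by rewrite integral0_eq ?adde0// => w _; rewrite subrr sqnorm0.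
Qed.

Lemma ls_estimate_location : is_ls_estimate P F Theta Y.
Proof.
split=> [i|W mW]; first by apply/measurable_wrtP; exact: mY.
rewrite unlock mse0 mse_location// leeDl// integral_ge0// => w _.
by rewrite lee_fin sqnorm_ge0.
Qed.

(** An optimal estimate has the same finite mean square error as [Y], which
    leaves nothing for the mean square of Y - est. *)
Lemma ls_estimate_unique (est : Omega -> 'cV[R]_k) :
  is_ls_estimate P F Theta est -> {ae P, forall w, est w = Y w}.
Proof.
move=> [mest /(_ Y)]; rewrite unlock mse0 mse_location// => le_mse.
have : (\int[P]_w (sqnorm (Y w - est w))%:E <= 0)%E.
  have := le_mse (fun i => (measurable_wrtP C _).2 (mY i)).
  by rewrite -[leRHS]adde0 leeD2lE.
move=> le0.
have mE : mcoord (fun w => Y w - est w).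
  exact: (mcoordB mYO (mcoord_sub (mcoord_wrt mest))).
have mS : measurable_fun setT (fun w => (sqnorm (Y w - est w))%:E).
  by apply/measurable_EFinP; exact: measurable_dot.
have : (\int[P]_w `|(sqnorm (Y w - est w))%:E| = 0)%E.
  apply/eqP; rewrite eq_le; apply/andP; split; last exact: integral_ge0.
  by under eq_integral do rewrite gee0_abs ?lee_fin ?sqnorm_ge0//.
move=> /(ae_eq_integral_abs _ measurableT mS).
apply: filterS => w /= /(_ Logic.I) [].
by move/sqnorm_eq0/eqP; rewrite subr_eq0 => /eqP ->.
Qed.

Lemma cond_cov_location (Y' : Omega -> 'cV[R]_k) i j :
  is_cond_mean P F Theta Y' ->
  is_cond_exp P F
    (fun w => (Theta w i ord0 - Y' w i ord0) * (Theta w j ord0 - Y' w j ord0))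
    (cst (V i j)).
Proof.
move=> meanY'.
have YY' l := cond_exp_unique CO (cond_mean_location l) (meanY' l).
have [iZ ZE] := residual_coord2 i j.
have mY' l : measurable_fun setT (fun w => Theta w l ord0 - Y' w l ord0).
  apply: measurable_funB => //; have [_ _ mY'l _] := meanY' l.
  exact: measurable_wrt_sub mY'l.
apply: (is_cond_exp_aeX CO (X := fun w =>
  (Theta w i ord0 - Y w i ord0) * (Theta w j ord0 - Y w j ord0))).
- split=> //; first exact: finite_measure_integrable_cst.
    by apply/measurable_wrtP; exact: measurable_cst.
  by move=> G FG; rewrite ZE.
- exact: measurable_funM.
- by apply: filterS2 (YY' i) (YY' j) => w -> ->.
Qed.

Lemma cond_mse_location (est : Omega -> 'cV[R]_k) :
  (forall i, measurable_wrt F (fun w => est w i ord0)) ->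
  {ae P, forall w, est w = Y w} ->
  is_cond_exp P F (fun w => sqnorm (Theta w - est w)) (cst (\tr V)).
Proof.
move=> /mcoord_wrt/mcoord_sub mest estY.
have mT : mcoord (fun w => Theta w - est w) by exact: mcoordB.
apply: (is_cond_exp_aeX CO (X := fun w => sqnorm (Theta w - Y w)));
  last 2 first.
- exact: measurable_dot.
- by apply: filterS estY => w ->.
have sE w : (sqnorm (Theta w - Y w))%:E = (\sum_i
    ((Theta w i ord0 - Y w i ord0) * (Theta w i ord0 - Y w i ord0))%:E)%E.
  rewrite sumEFin sqnormE; congr EFin; apply: eq_bigr => i _.
  by rewrite !mxE expr2.
have iS i : P.-integrable setT (fun w =>
    ((Theta w i ord0 - Y w i ord0) * (Theta w i ord0 - Y w i ord0))%:E).
  by have [] := residual_coord2 i i.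
split.
- have := integrable_sum measurableT (index_enum 'I_k) (P := xpredT)
    (fun i _ => iS i).
  by apply: eq_integrable => // w _; rewrite /= sE.
- exact: finite_measure_integrable_cst.
- by apply/measurable_wrtP; exact: measurable_cst.
- move=> G FG; have mG := CO FG.
  under [RHS]eq_integral do rewrite sE.
  rewrite integral_sum//; last by move=> i; exact: integrableS (iS i).
  transitivity (\int[P]_(w in G) \sum_i (V i i)%:E)%E.
    by apply: eq_integral => w _; rewrite sumEFin.
  rewrite integral_sum//.
    by apply: eq_bigr => i _; rewrite (residual_coord2 i i).2.
  by move=> i; exact: finite_measure_integrable_cst.
Qed.

(** The F-measurable version [Y] of [mu] is one solution of each problem;
    uniqueness of least squares estimates and of conditional expectations
    carries its properties over to all others. *)
Lemma ls_location (mu : Omega -> 'cV[R]_k) :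
  {ae P, forall w, Y w = mu w} ->
  [/\ exists est, is_ls_estimate P F Theta est,
      exists K, is_cond_cov P F Theta K &
      forall (est : Omega -> 'cV[R]_k) (K : Omega -> 'M[R]_k),
        is_ls_estimate P F Theta est -> is_cond_cov P F Theta K ->
        [/\ is_cond_mean P F Theta est,
            {ae P, forall w, est w = mu w},
            cond_exp_eq P F (fun w => sqnorm (Theta w - est w))
              (fun w => \tr (K w)) &
            {ae P, forall w, K w = V}]].
Proof.
move=> Ymu; split.
- by exists Y; exact: ls_estimate_location.
- exists (cst V); exists Y; first exact: cond_mean_location.
  by move=> i j; apply: cond_cov_location; exact: cond_mean_location.
move=> est K est_ls [Y' meanY' covK].
have estY := ls_estimate_unique est_ls.
have KV : {ae P, forall w, K w = V}.
  have : {ae P, forall w, forall i j, K w i j = V i j}.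
    apply: filter_forall => i; apply: filter_forall => j.
    exact: (cond_exp_unique CO (covK i j) (cond_cov_location i j meanY')).
  by apply: filterS => w KVw; apply/matrixP.
split=> //.
- move=> i; apply: (is_cond_exp_ae CO (cond_mean_location i)).
    by have [+ _] := est_ls; exact.
  by apply: filterS estY => w ->.
- by apply: filterS2 estY Ymu => w -> ->.
- exists (cst (\tr V)).
    by apply: cond_mse_location => //; have [] := est_ls.
  by apply: filterS KV => w ->.
Qed.

End least_squares.
(** * Centred Gaussian laws *)

Section gaussian_prob.
Context {R : realType} {k : nat}.
Local Notation lam := (lebesgue_tuple R k).
Variable A : 'M[R]_k.
Hypotheses (A_sym : A^T = A) (A_unit : A \in unitmx)
  (A_mass : (0 < gmass A < +oo)%E).

Let gpdf_ge0 (x : Rtuple k R) : 0 <= gpdf A (vec x - 0).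
Proof. exact/ltW/gpdf_gt0. Qed.

(** The normal law with mean 0 and precision matrix [A]. *)
Definition gaussian_prob : probability (Rtuple k R) R :=
  density_prob (measurable_gpdf A 0) gpdf_ge0 (integral_gpdf A_mass 0).

Lemma gaussian_prob_tshift c B : measurable B ->
  (gaussian_prob (tshift c @^-1` B) =
   \int[lam]_(x in B) (gpdf A (vec x - c))%:E)%E.
Proof.
move=> mB.
pose f (x : Rtuple k R) : \bar R := ((gpdf A (vec x - c))%:E * (\1_B x)%:E)%E.
have mf : measurable_fun setT f.
  by apply: emeasurable_funM; apply/measurable_EFinP;
    [exact: measurable_gpdf|exact: measurable_indic].
have f0 x : (0 <= f x)%E.
  by rewrite mule_ge0 ?lee_fin//; exact/ltW/gpdf_gt0.
rewrite [RHS]integral_mkcond.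
rewrite -[RHS]/(\int[lam]_x ((fun y => (gpdf A (vec y - c))%:E) \_ B) x)%E.
rewrite epatch_indic -(ge0_integral_tshift c mf f0).
rewrite /gaussian_prob /= /density_measure integral_mkcond epatch_indic.
by apply: eq_integral => x _; rewrite /f /tshift unvecK addrK subr0.
Qed.

(** The density is positive, so a null slab would be Lebesgue null. *)
Lemma gaussian_prob_slab (i : 'I_k) (r s : R) : r < s ->
  gaussian_prob [set x | r < vec x i ord0 <= s] != 0%E.
Proof.
move=> rs; set N := [set x | _].
have lamT : lam setT != 0%E.
  apply: contraTneq A_mass => lamT; rewrite negb_and -!leNgt; apply/orP; left.
  rewrite /gmass null_set_integral//; apply/measurable_EFinP.
  by have := @measurable_gexp _ _ A 0; under eq_fun do rewrite subr0.
have := lebesgue_slab_neq0 i lamT rs; apply: contra_neq => N0.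
have mN : measurable N by exact: measurable_slab.
have mg : measurable_fun N (fun x : Rtuple k R => (gpdf A (vec x - 0))%:E).
  by apply/measurable_funTS/measurable_EFinP; exact: measurable_gpdf.
have : (\int[lam]_(x in N) `|(gpdf A (vec x - 0))%:E| = 0)%E.
  by rewrite -[RHS]N0; apply: eq_integral => x _; rewrite gee0_abs ?lee_fin.
move=> /(ae_eq_integral_abs _ mN mg) [M [mM M0 NM]].
apply: (subset_measure0 mN mM) => // x Nx; apply: NM => /= /(_ Nx) [] /eqP.
by rewrite gt_eqF// gpdf_gt0.
Qed.

Lemma gaussian_prob_mgf b :
  (\int[gaussian_prob]_x (expR (dot b (vec x)))%:E =
   (expR (2^-1 * dot b (invmx A *m b)))%:E)%E.
Proof.
rewrite (integral_density (mu := lam) (measurable_gpdf A 0))//.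
- by rewrite -gpdf_mgf.
- apply/measurable_EFinP; apply: measurableT_comp => //.
  by apply: measurable_dot; [exact: mcoord_cst|exact: mcoord_vec].
Qed.

Lemma gaussian_prob_dot b :
  [/\ gaussian_prob.-integrable setT (fun x => (dot b (vec x))%:E),
      gaussian_prob.-integrable setT (fun x => (dot b (vec x) ^+ 2)%:E),
      \int[gaussian_prob]_x dot b (vec x) = 0 &
      \int[gaussian_prob]_x (dot b (vec x) ^+ 2) = dot b (invmx A *m b)].
Proof.
apply: gaussian_moments => [|s].
  by apply: measurable_dot; [exact: mcoord_cst|exact: mcoord_vec].
under eq_integral do rewrite -dotZl.
by rewrite gaussian_prob_mgf -scalemxAr dotZl dotZr mulrA -expr2.
Qed.

Lemma gaussian_prob_mean i :
  gaussian_prob.-integrable setT (fun x => (vec x i ord0)%:E) /\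
  \int[gaussian_prob]_x vec x i ord0 = 0.
Proof.
have [+ _ + _] := gaussian_prob_dot (delta_mx i ord0).
by under eq_fun do rewrite dot_delta;
  under [X in X = 0 -> _]eq_Rintegral do rewrite dot_delta.
Qed.

(** Polarization: the second moments of x_i, x_j and x_i + x_j are known. *)
Lemma gaussian_prob_cov i j :
  gaussian_prob.-integrable setT (fun x => (vec x i ord0 * vec x j ord0)%:E) /\
  \int[gaussian_prob]_x (vec x i ord0 * vec x j ord0) = invmx A i j.
Proof.
pose e (l : 'I_k) : 'cV[R]_k := delta_mx l ord0.
have [_ ii _ Ei] := gaussian_prob_dot (e i).
have [_ ij _ Ej] := gaussian_prob_dot (e j).
have [_ is_ _ Es] := gaussian_prob_dot (e i + e j).
have pE x : vec x i ord0 * vec x j ord0 = 2^-1 * (dot (e i + e j) (vec x) ^+ 2 -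
    (dot (e i) (vec x) ^+ 2 + dot (e j) (vec x) ^+ 2)).
  by rewrite dotDl !dot_delta; field.
have iD := integrableD measurableT ii ij.
have iB := integrableB measurableT is_ iD.
split.
  have := integrableZl measurableT 2^-1 iB.
  by apply: eq_integrable => // x _; rewrite pE.
under eq_Rintegral do rewrite pE.
rewrite (RintegralZl _ measurableT iB) (RintegralB measurableT is_ iD).
rewrite (RintegralD measurableT ii ij) Ei Ej Es.
have VE l l' : dot (e l) (invmx A *m e l') = invmx A l l'.
  by rewrite dot_delta -colE mxE.
have Vji : invmx A j i = invmx A i j by rewrite -[in LHS](invmx_sym A_sym) mxE.
by rewrite mulmxDr !(dotDl, dotDr) !VE Vji; field.
Qed.

(** The law of [X] is the translate by [a] of the centred Gaussian law, whose
    second moments are finite. *)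
Lemma gaussian_density_sqr d (Omega : measurableType d)
    (P : probability Omega R) (X : Omega -> 'cV[R]_k)
    (p : 'cV[R]_k -> R) (a : 'cV[R]_k) :
  mcoord X -> has_density P X p -> (forall y, p y = gpdf A (y - a)) ->
  forall i, P.-integrable setT (fun w => (X w i ord0 ^+ 2)%:E).
Proof.
move=> mX Xp pE i.
have mXt := measurable_unvec mX; have ma := measurable_tshift a.
pose f (x : Rtuple k R) : \bar R := (vec x i ord0 ^+ 2)%:E.
have mf : measurable_fun setT f.
  by apply/measurable_EFinP; apply: measurable_funX; exact: mcoord_vec.
have f0 x : (0 <= f x)%E by rewrite lee_fin sqr_ge0.
have fE : (\int[P]_w f (unvec (X w)) = \int[gaussian_prob]_x f (tshift a x))%E.
  rewrite -[LHS]/(\int[P]_(w in (fun w => unvec (X w)) @^-1` setT)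
    (f \o (fun w => unvec (X w))) w)%E.
  rewrite -[RHS]/(\int[gaussian_prob]_(x in tshift a @^-1` setT)
    (f \o tshift a) x)%E.
  rewrite -(ge0_integral_pushforward mXt)// -(ge0_integral_pushforward ma)//.
  apply: eq_measure_integral => B mB _.
  rewrite /pushforward; transitivity (\int[lam]_(x in B) (p (vec x))%:E)%E.
    exact: Xp.
  rewrite [RHS]gaussian_prob_tshift//.
  by apply: eq_integral => x _; rewrite pE.
apply/integrableP; split.
  by apply/measurable_EFinP; apply: measurable_funX; exact: mX.
have -> : (\int[P]_w `|(X w i ord0 ^+ 2)%:E| = \int[P]_w f (unvec (X w)))%E.
  by apply: eq_integral => w _; rewrite /f unvecK gee0_abs ?lee_fin ?sqr_ge0.
have [i1 _] := gaussian_prob_mean i; have [i2 _] := gaussian_prob_cov i i.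
have i0 : gaussian_prob.-integrable setT (fun=> (a i ord0 ^+ 2)%:E).
  exact: finite_measure_integrable_cst.
have i12 := integrableD measurableT i2
  (integrableD measurableT (integrableZl measurableT (2 * a i ord0) i1) i0).
rewrite fE; have : gaussian_prob.-integrable setT (fun x => f (tshift a x)).
  apply: eq_integrable i12 => // x _; rewrite /f /tshift unvecK [in RHS]mxE.
  by rewrite -!EFinM -!EFinD; congr EFin; ring.
by move=> /integrableP[_]; under eq_integral do rewrite gee0_abs//.
Qed.

End gaussian_prob.

(** The posterior is the normal law with precision matrix L + S^-1, translated
    to the posterior mean. *)
Lemma Rintegral_bayes_density (R : realType) k (a : 'cV[R]_k) (S L : 'M[R]_k) v
    (A := L + invmx S) (massA : (0 < gmass A < +oo)%E) B :
  (\int[lebesgue_tuple R k]_x (mvnormal_pdf a S (vec x))%:E = 1)%E ->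
  S^T = S -> A^T = A -> A \in unitmx -> measurable B ->
  \int[lebesgue_tuple R k]_(x in B)
    bayes_density (mvnormal_pdf a S) (likelihood v L) (vec x) =
  fine (gaussian_prob massA
    (tshift (invmx A *m (v + invmx S *m a)) @^-1` B)).
Proof.
move=> pdf1 sS sA uA mB; rewrite (gaussian_prob_tshift massA _ mB) /Rintegral.
apply: (congr1 fine); apply: eq_integral => x _; apply: (congr1 EFin).
exact: (bayes_density_gpdf v (vec x) pdf1 sS sA uA massA).
Qed.

(** * The information matrix of the observation *)

Section gram.
Context d (T : measurableType d) {R : realType} {k : nat}.
Variables (mu : {measure set T -> \bar R}) (D : set T) (g : 'I_k -> T -> R)
  (h : T -> R).
Hypotheses (mD : measurable D) (mg : forall i, measurable_fun D (g i))
  (mh : measurable_fun D h) (h0 : forall s, 0 <= h s)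
  (g2 : forall i, mu.-integrable D (fun s => (g i s ^+ 2 * h s)%:E)).

Definition gram : 'M[R]_k :=
  \matrix_(i, j) \int[mu]_(s in D) (g i s * g j s * h s).

Lemma gram_sym : gram^T = gram.
Proof.
apply/matrixP => i j; rewrite !mxE; apply: eq_Rintegral => s _.
by congr (_ * _); exact: mulrC.
Qed.

(** x.Gx is the integral of (sum_i x_i g_i)^2 h. *)
Lemma gram_ge0 x : 0 <= dot x (gram *m x).
Proof.
have iij i j : mu.-integrable D (fun s => (g i s * g j s * h s)%:E).
  have := integrableD mD (g2 i) (g2 j); apply: le_integrable => //.
    apply/measurable_EFinP; apply: measurable_funM => //.
    exact: measurable_funM.
  move=> s _; rewrite -EFinD lee_fin -mulrDl !normrM ler_wpM2r//.
  rewrite [leRHS]ger0_norm ?addr_ge0 ?sqr_ge0//.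
  rewrite -(real_normK (num_real (g i s))) -(real_normK (num_real (g j s))).
  have := sqr_ge0 (`|g i s| - `|g j s|).
  have := normr_ge0 (g i s); have := normr_ge0 (g j s); nra.
pose f i j s := x i ord0 * x j ord0 * (g i s * g j s * h s).
have iF i j : mu.-integrable D (fun s => (f i j s)%:E).
  exact: (integrableZl mD (x i ord0 * x j ord0) (iij i j)).
have iFs i : mu.-integrable D (fun s => \sum_j (f i j s)%:E)%E.
  exact: integrable_sum.
have -> : dot x (gram *m x) =
    fine (\int[mu]_(s in D) \sum_i \sum_j (f i j s)%:E)%E.
  rewrite integral_sum// dotE.
  under [in RHS]eq_bigr do rewrite integral_sum//.
  have fE i j : (\int[mu]_(s in D) (f i j s)%:E =
      (x i ord0 * (gram i j * x j ord0))%:E)%E.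
    rewrite -[LHS]fineK; last exact: integrable_fin_num.
    congr EFin; rewrite -[LHS]/(\int[mu]_(s in D) f i j s).
    by rewrite (RintegralZl _ mD (iij i j)) mxE; ring.
  under [in RHS]eq_bigr do under eq_bigr do rewrite fE.
  under [in RHS]eq_bigr do rewrite sumEFin -mulr_sumr.
  by rewrite sumEFin; apply: eq_bigr => i _; rewrite mxE.
apply/fine_ge0/integral_ge0 => s _.
have -> : (\sum_i \sum_j (f i j s)%:E =
    ((\sum_i x i ord0 * g i s) ^+ 2 * h s)%:E)%E.
  rewrite expr2 mulr_suml mulr_suml -sumEFin; apply: eq_bigr => i _.
  rewrite mulr_sumr mulr_suml -sumEFin; apply: eq_bigr => j _.
  by congr EFin; rewrite /f; ring.
by rewrite lee_fin mulr_ge0 ?sqr_ge0.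
Qed.

End gram.

Section information.
Context {R : realType}.
Implicit Types H t s : R.

Lemma Gamma_ge0 (x : R) : 0 <= Gamma x.
Proof.
by apply: Rintegral_ge0 => s _; rewrite mulr_ge0 ?powR_ge0 ?expR_ge0.
Qed.

Lemma dwH_ge0 H s : 0 < H < 1 -> 0 <= dwH H s.
Proof.
move=> /andP[H0 H1]; have H2 : 0 <= 2 - 2 * H by lra.
have H3 : 0 <= 2 * H by lra.
apply: mulr_ge0; last exact: powR_ge0; apply: mulr_ge0 => //.
have G0 := @Gamma_ge0; rewrite invr_ge0 /lambdaH; apply: mulr_ge0.
  by apply: mulr_ge0 => //; exact: mulr_ge0.
by rewrite invr_ge0.
Qed.

Lemma measurable_dwH H (D : set R) : measurable_fun D (dwH H).
Proof.
by apply: measurable_funTS; apply: measurable_funM => //;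
  exact: measurable_powR.
Qed.

Lemma RH_gram n H (phi : 'I_n.+1 -> R -> R) (sigma : R -> R) t :
  RH H phi sigma t = gram lebesgue_measure `[0, t] (psi H phi sigma) (dwH H).
Proof. by []. Qed.

End information.
(** * The Bayesian estimate *)

Theorem theorem3 (d : measure_display) (Omega : measurableType d)
  (R : realType) (P : probability Omega R)
  (T H : R) (n : nat)
  (phi : 'I_n.+1 -> R -> R) (sigma : R -> R)
  (B : R -> {RV P >-> R}) (theta : 'I_n.+1 -> {RV P >-> R})
  (m : 'cV[R]_n.+1) (Sigma : 'M[R]_n.+1)
  (M : R -> {RV P >-> R}) (psiH : 'I_n.+1 -> {RV P >-> R}) (t : R)
  (T_gt0 : 0 < T) (H_in01 : 0 < H < 1) (t_in0T : 0 <= t <= T)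
  (* fractional Brownian noise *)
  (B_fBm : is_fBm T H B)
  (* phi_i, sigma, and the well-definedness of the expressions in them *)
  (phi_int : forall i,
     (@lebesgue_measure R).-integrable `[0, T] (EFin \o phi i))
  (sigma_L2 : measurable_fun `[0, T] sigma /\
     (@lebesgue_measure R).-integrable `[0, T] (fun s => (sigma s ^+ 2)%:E))
  (sigma_neq0 : forall s, 0 <= s <= T -> sigma s != 0)
  (phi_derivable : forall i s, 0 < s < T -> derivable (phi i) s 1)
  (dphi_int : forall i,
     (@lebesgue_measure R).-integrable `[0, T] (EFin \o derive1 (phi i)))
  (k_dphi_int : forall i u, 0 <= u <= T ->
     (@lebesgue_measure R).-integrable `[0, u]
       (fun s => (kH H u s * derive1 (phi i) s)%:E))
  (k_invsigma_dphi_int : forall i u, 0 <= u <= T ->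
     (@lebesgue_measure R).-integrable `[0, u]
       (fun s => (kH H u s * (sigma s)^-1 * derive1 (phi i) s)%:E))
  (psi_derivable : forall i s, 0 < s < T ->
     derivable (kernel_transform H sigma (phi i)) s 1)
  (psi_L2 : forall i, measurable_fun `[0, T] (psi H phi sigma i) /\
     (@lebesgue_measure R).-integrable `[0, T]
       (fun s => (psi H phi sigma i s ^+ 2 * dwH H s)%:E))
  (* theta is multivariate normal, independent of B *)
  (Sigma_cov : covariance_matrix Sigma) (Sigma_unit : Sigma \in unitmx)
  (theta_normal : has_density P (fun w => \col_i theta i w)
     (mvnormal_pdf m Sigma))
  (theta_indep : independent_sigma P (sigma_gen setT theta)
     (sigma_gen `[0, T] B))
  (* M^H_u is the integral of k_H(u, .) against xi *)
  (M_integral : forall u, 0 <= u <= T ->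
     is_dxi_integral phi sigma theta B u (kH H u) (M u))
  (* (psi^H_t)_i is the integral of psi_i against M^H *)
  (psiH_integral : forall i,
     is_integral (L2w_size H t) M t (psi H phi sigma i) (psiH i))
  (* generalized Bayes rule *)
  (bayes_rule :
     is_cond_density P (sigma_gen `[0, t] (observed phi sigma theta B))
       (fun w => \col_i theta i w)
       (fun x w => bayes_density (mvnormal_pdf m Sigma)
          (likelihood (\col_i psiH i w) (RH H phi sigma t)) x)) :
  let F := sigma_gen `[0, t] (observed phi sigma theta B) in
  let Theta := fun w => \col_i theta i w : 'cV[R]_n.+1 in
  let PsiH := fun w => \col_i psiH i w : 'cV[R]_n.+1 in
  let A := RH H phi sigma t + invmx Sigma in
  [/\ A \in unitmx,
      exists est, is_ls_estimate P F Theta est,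
      exists K, is_cond_cov P F Theta K &
      forall (est : Omega -> 'cV[R]_n.+1) (K : Omega -> 'M[R]_n.+1),
        is_ls_estimate P F Theta est -> is_cond_cov P F Theta K ->
        [/\ is_cond_mean P F Theta est,
            {ae P, forall w,
               est w = invmx A *m (PsiH w + invmx Sigma *m m)},
            cond_exp_eq P F (fun w => sqnorm (Theta w - est w))
              (fun w => \tr (K w)) &
            {ae P, forall w, K w = invmx A}]].
Proof.
have [_ tT] := andP t_in0T.
set C := \bigcup_(s in `[0, t]%classic)
  preimage_set_system setT (observed phi sigma theta B s) measurable.
have CO : <<s C >> `<=` @measurable _ Omega.
  apply: smallest_sub; first exact: sigma_algebra_measurable.
  move=> _ [s _ [U mU <-]]; apply: (_ : measurable_fun setT _) => //.
  apply: measurable_funD; last exact: measurable_funM.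
  by apply: measurable_sum => i; exact: measurable_funM.
move=> F Theta PsiH A.
have mTheta : mcoord Theta.
  move=> i; rewrite (_ : (fun _ => _) = theta i)//.
  by apply/funext => w; rewrite mxE.
have pdf1 :
    (\int[lebesgue_tuple R n.+1]_x (mvnormal_pdf m Sigma (vec x))%:E = 1)%E.
  have := theta_normal _ measurableT; rewrite preimage_setT probability_setT.
  by move->.
have [massS pdfE] := mvnormal_gpdf pdf1.
have pS := covariance_posdef Sigma_cov Sigma_unit.
have pS' := posdef_inv pS.
have sS := pS.1.
have uS' := posdef_unit pS'.
have subT : `[0, t] `<=` `[0, T].
  by move=> s /=; rewrite !in_itv/= => /andP[-> /le_trans]; apply.
have mI : measurable (`[0, t]%classic : set R) by exact: measurable_itv.
have mI' : measurable (`[0, T]%classic : set R) by exact: measurable_itv.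
have psi_meas i : measurable_fun `[0, t] (psi H phi sigma i).
  by apply: measurable_funS (psi_L2 i).1.
have psi_sqr i : (@lebesgue_measure R).-integrable `[0, t]
    (fun s => (psi H phi sigma i s ^+ 2 * dwH H s)%:E).
  exact: integrableS (psi_L2 i).2.
have RH0 x : 0 <= dot x (RH H phi sigma t *m x).
  rewrite RH_gram; apply: gram_ge0 => //; first exact: measurable_dwH.
  by move=> s; exact: dwH_ge0.
have pA : posdef A.
  by apply: posdefD_psd => //; rewrite RH_gram; exact: gram_sym.
have uA := posdef_unit pA; have sA := pA.1.
have massA : (0 < gmass A < +oo)%E.
  by apply: gmass_le massS => x; rewrite mulmxDl dotDr lerDr.
pose gam := gaussian_prob massA.
pose mu w := invmx A *m (PsiH w + invmx Sigma *m m).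
have Theta_cond U : measurable U ->
    cond_exp_eq P F (fun w => \1_U (unvec (Theta w)))
      (fun w => fine (gam (tshift (mu w) @^-1` U))).
  move=> mU; have [Y condY YE] := bayes_rule _ mU; exists Y; first exact: condY.
  apply: filterS YE => w /= ->.
  exact: Rintegral_bayes_density pdf1 sS sA uA mU.
have slab (i : 'I_n.+1) (r s : R) : r < s ->
  gam [set x | r < vec x i ord0 <= s] != 0%E by exact: gaussian_prob_slab.
have [Y mY YE] := cond_location_version Theta_cond slab.
have mean i := gaussian_prob_mean sA uA massA i.
have cov i j := gaussian_prob_cov sA uA massA i j.
have Theta2 := gaussian_density_sqr (invmx_sym sS) uS' massS mTheta theta_normal
  pdfE.
have residual := ge0_integral_residual CO mTheta Theta_cond mY YE.
have [] := ls_location mTheta mY residual (fun i => (mean i).1)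
  (fun i j => (cov i j).1) (fun i => (mean i).2) (fun i j => (cov i j).2)
  Theta2 YE.
by split; first exact: uA.
Qed.
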